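(* Suppose $q$ is an odd prime power, and let $n$ be such that $n\mid (q^3-q)$. Let $c(n,q)$ denote the number of conjugacy classes of ${\rm SL}_2(\mathbb F_q)$ which are $n$-th powers, let $s(n,q)$ denote the number of elements of ${\rm SL}_2(\mathbb F_q)$ which are $n$-th powers, and put $c(n)=\lim_{q\to\infty}\frac{c(n,q)}{q+4}$ and $s(n)=\lim_{q\to\infty}\frac{s(n,q)}{q^3-q}$. Then: (1) For $n=2$: - if $q\equiv 1\pmod 4$: $c(2,q)=\frac{q+5}{2}$ and $s(2,q)=\frac{q^2(q-1)}{2}-q+1$; - if $q\equiv 3\pmod 4$: $c(2,q)=\frac{q+5}{2}$ and $s(2,q)=\frac{q^2(q-1)}{2}+1$. Thus $c(2)=s(2)=\frac12$. (2) For $n=4$: - if $q\equiv 1\pmod 8$: $c(4,q)=\frac{3q+21}{8}$ and $s(4,q)=\frac38 q^3-\frac12 q^2-\frac78 q+1$; - if $q\equiv 3\pmod 8$: $c(4,q)=\frac{3q+15}{8}$ and $s(4,q)=\frac38(q^3-q)$; - if $q\equiv 5\pmod 8$: $c(4,q)=\frac{3q+17}{8}$ and $s(4,q)=\frac38(q^3-q)$; - if $q\equiv 7\pmod 8$: $c(4,q)=\frac{3q+11}{8}$ and $s(4,q)=\frac38 q^3-\frac12 q^2+\frac18 q+1$. Thus $c(4)=s(4)=\frac38$. (3) When $n$ is an odd prime: - if $n\mid q$: $c(n,q)=q$ and $s(n,q)=(q-2)(q^2-1)$; - if $n\mid (q-1)$: $c(n,q)=\frac{(n+1)(q-1)}{2n}+5$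 and $s(n,q)=\frac{(n+1)(q^3-q)}{2n}$; - if $n\mid (q+1)$: $c(n,q)=\frac{(n+1)(q-3)+4}{2n}+5$ and $s(n,q)=\frac{(n+1)(q^3-q)}{2n}$. Thus $c(n)=s(n)=\frac{n+1}{2n}$.
   Context: An element $g$ of a group $G$ is an $n$-th power if $g=x^n$ for some $x\in G$; this property depends only on the conjugacy class of $g$. For $q$ odd, ${\rm SL}_2(\mathbb F_q)$ has order $q^3-q$ and exactly $q+4$ conjugacy classes.
   Formalization: For n=4, q≡7 (mod 8), c(4,q) is (3q+19)/8 instead of (3q+11)/8 (false: c(4,7)=5); for odd prime n the limits c(n), s(n) are taken over q not divisible by n, since along q=n^k the ratios tend to 1. *)

(* Defs.v *)
From HB Require Import structures.
From mathcomp Require Import all_boot all_order all_algebra all_fingroup all_solvable all_field.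
From mathcomp Require Import all_classical all_reals all_analysis.
Import Order.TTheory GRing.Theory Num.Theory.
Import numFieldNormedType.Exports.

Set Implicit Arguments.
Unset Strict Implicit.
Unset Printing Implicit Defensive.

Local Open Scope ring_scope.

Definition SL2 (F : finFieldType) : {set {'GL_2[F]}} :=
  [set g | \det (GLval g) == 1]%SET.

Lemma SL2_group_set (F : finFieldType) : group_set (SL2 F).
Proof.
apply/group_setP; split=> [|g h]; rewrite !inE.
  by rewrite GL_1E det1.
by move=> /eqP dg /eqP dh; rewrite GL_MxE det_mulmx dg dh mulr1.
Qed.

Canonical SL2_group (F : finFieldType) := Group (@SL2_group_set F).

Section Powers.
Local Open Scope group_scope.
Variables (gT : finGroupType) (n : nat) (G : {set gT}).

Definition nth_powers : {set gT} := [set x ^+ n | x in G]%SET.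

(* Being an n-th power is a property of the conjugacy class, so asking it of
   all elements of a class or of one of them is the same. *)
Definition nth_power_classes : {set {set gT}} :=
  [set C in classes G | C \subset nth_powers]%SET.

End Powers.

Definition num_pow (n : nat) (F : finFieldType) : nat :=
  #|nth_powers n (SL2 F)|.

Definition num_pow_classes (n : nat) (F : finFieldType) : nat :=
  #|nth_power_classes n (SL2 F)|.

Definition odd_prime_power (q : nat) : Prop :=
  odd q /\ exists p k : nat, [/\ prime p, (0 < k)%N & q = (p ^ k)%N].

(* The field with q elements; junk value 'F_2 when q is not a prime power. *)
Definition GF (q : nat) : finFieldType :=
  match @idP (prime (pdiv q)), @idP (0 < logn (pdiv q) q)%N with
  | ReflectT p_pr, ReflectT k_gt0 => s2val (pPrimePowerField p_pr k_gt0)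
  | _, _ => 'F_2
  end.

Lemma card_GF (q : nat) : odd_prime_power q -> #|GF q| = q.
Proof.
case=> _ [p [k [p_pr k_gt0 ->]]].
have Ep : pdiv (p ^ k) = p by rewrite -(prednK k_gt0) pdiv_pfactor.
have Ek : logn (pdiv (p ^ k)) (p ^ k) = k by rewrite Ep pfactorK.
rewrite /GF; destruct (@idP (prime (pdiv (p ^ k)))) as [p1|p1]; last first.
  by case: p1; rewrite Ep.
destruct (@idP (0 < logn (pdiv (p ^ k)) (p ^ k))%N) as [k1|k1]; last first.
  by case: k1; rewrite Ek.
by case: (pPrimePowerField p1 k1) => F /= _ ->; rewrite Ek Ep.
Qed.

(* The filter "q -> oo" for the limits: q ranges over the odd prime powers such
   that n divides q^3 - q. *)
Definition q_infty (n : nat) : set_system nat :=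
  within [set q | odd_prime_power q /\ (n %| q ^ 3 - q)%N]%classic \oo%classic.

(* The limits along [q_infty n] are not vacuous, even if q is required to be
   coprime to n. *)
Lemma q_infty_coprime (n N : nat) : (0 < n)%N ->
  exists q : nat,
    [/\ odd_prime_power q, (n %| q ^ 3 - q)%N, coprime n q & (N <= q)%N].
Proof.
move=> n_gt0; have [p p_gt p_pr] := prime_above (maxn n 2).
have [n_lt p_gt2] : (n < p)%N /\ (2 < p)%N.
  by apply/andP; rewrite -gtn_max.
have cpn : coprime p n by rewrite prime_coprime // gtnNdvd.
pose k := (totient n * N.+1)%N.
have k_gt0 : (0 < k)%N by rewrite muln_gt0 totient_gt0 n_gt0.
exists (p ^ k)%N; split.
- split; last by exists p, k.
  by rewrite oddX orbC; case: (even_prime p_pr) p_gt2 => [->|->].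
- rewrite expnS -[X in (_ - X)%N]muln1 -mulnBr dvdn_mull //.
  rewrite -eqn_mod_dvd ?expn_gt0 ?(prime_gt0 p_pr) //.
  rewrite /k -expnM -mulnA expnM -modnXm (Euler_exp_totient cpn).
  by rewrite modnXm exp1n.
- by rewrite coprimeXr // coprime_sym.
- apply: leq_trans (ltnW (ltn_expl k (prime_gt1 p_pr))).
  by rewrite (leq_trans (leqnSn N)) // leq_pmull // totient_gt0.
Qed.

(* Main.v *)
(* For [g] in SL_2(F_q) that is not central, the centralizer of [g] consists of
   the [a + b g] of determinant 1, so it is governed by the trace of [g]. If
   [tr g <> 2, -2], then the centralizer is a torus, cyclic of order [q - 1] or
   [q + 1] according to whether [(tr g)^2 - 4] is a square; the elements of
   trace [tr g] form a single class, and the torus contains exactly two elements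
   of each trace of the same type. As any n-th root of [g] lies in this torus,
   the n-th powers with noncentral semisimple class are counted by the
   subgroup of n-th powers of a cyclic group. The elements of trace 2 or -2 are
   [1 + N] or [- (1 + N)] with [N^2 = 0], and [(1 + N)^n = 1 + n N]. Finally the
   number of classes in a normal set is the average over the group of the
   orders of the centralizers of its elements. *)
Require Import Defs.
From HB Require Import structures.
From mathcomp Require Import all_boot all_order all_algebra all_fingroup all_solvable all_field.
From mathcomp Require Import ring lra zify.
Import Order.TTheory GRing.Theory Num.Theory.

Set Implicit Arguments.
Unset Strict Implicit.
Unset Printing Implicit Defensive.

(** * Squares in finite fields of odd order *)

(** No classification of conjugacy classes and no explicit torus is used. For noncentral [g] of
    trace [t], an element [a + b g] has trace [s] and determinant 1 exactly when
    [b ^+ 2 * disc t = disc s] and [2 a = s - b t]; centralizer orders, and the fact that a trace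
    other than 2 and -2 fills one class, follow by counting solutions of this equation, which only
    sees square classes. An extension field enters only for the cyclicity of tori, where one
    eigenvector treats the split and the nonsplit type together. Two points need care. First, -1
    lies in tori of both types, so whether it is an n-th power combines the parities of two subgroup
    orders. Second, trace does not separate the noncentral classes of trace 2 or of trace -2. They
    need not be separated: they occur only through the total centralizer order
    [(q ^ 2 - 1) * (2 * q) = 2 * #|G|], which stands for two classes. Thus a single weighted sum
    over the n-th powers gives both the elements (weight 1) and the classes (weight the centralizer
    order). For [q = 3] there is no split trace at all, which forces separate treatment of an empty
    set of traces. *)

Section FieldCounting.
Variable F : finFieldType.
Local Open Scope ring_scope.
Local Notation q := #|F|.

Lemma prime_dvd_card_finField (n : nat) :
  prime n -> (n %| q)%N = (n%:R == 0 :> F).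
Proof.
move=> n_pr; have [p p_pr pF] := finPcharP F.
have qE : q = (p ^ logn p q)%N by exact: (card_pprimeChar pF).
rewrite -(dvdn_pcharf pF) {1}qE Euclid_dvdX // (dvdn_prime2 n_pr p_pr).
rewrite (dvdn_prime2 p_pr n_pr) eq_sym andbC.
by case: (logn p q) qE (finNzRing_gt1 F) => [->|].
Qed.

Lemma coprime_card_finField (n : nat) :
  coprime n q -> n%:R != 0 :> F.
Proof.
move=> co; have [p p_pr pF] := finPcharP F.
rewrite -(dvdn_pcharf pF); apply/negP => pn.
have : (p %| gcdn n q)%N.
  by rewrite dvdn_gcd pn prime_dvd_card_finField // (pcharf0 pF) /=.
by rewrite (eqP co) dvdn1; case: eqP p_pr => // ->.
Qed.

Hypothesis q_odd : odd q.

Lemma two_neq0_odd_card : 2%:R != 0 :> F.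
Proof. by rewrite -prime_dvd_card_finField // dvdn2 q_odd. Qed.
Let two_neq0 := two_neq0_odd_card.

Lemma four_neq0_odd_card : 4%:R != 0 :> F.
Proof. by rewrite (natrM _ 2 2) mulf_neq0. Qed.

Definition is_sqr (d : F) : bool := [exists b, b ^+ 2 == d].
Definition num_sqrt (d : F) : nat := #|[set b : F | b ^+ 2 == d]|.

Lemma neq_opp (b : F) : b != 0 -> b != - b.
Proof.
move=> b0; rewrite -subr_eq0 opprK -mulr2n -mulr_natr mulf_neq0 //.
Qed.

Lemma num_sqrtE (d : F) :
  num_sqrt d = if d == 0 then 1%N else (is_sqr d).*2.
Proof.
rewrite /num_sqrt; case: eqP => [->|/eqP d0].
  rewrite (_ : [set b | _] = [set 0]) ?cards1 //.
  by apply/setP=> b; rewrite !inE sqrf_eq0.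
case: (boolP (is_sqr d)) => [/existsP[b /eqP bd]|/existsPn nsq].
  have b0 : b != 0 by rewrite -sqrf_eq0 bd.
  rewrite (_ : [set _ | _] = [set b; - b]) ?cards2 ?neq_opp //.
  by apply/setP=> c; rewrite !inE -bd eqf_sqr.
by apply/eqP; rewrite cards_eq0; apply/eqP/setP=> b; rewrite !inE (negPf (nsq b)).
Qed.

(** The fibres of squaring have size 1 over 0, 2 over a nonzero square and 0 elsewhere, and their
    sizes add up to [q]. *)
Lemma card_sqr_nonzero : (#|[set d : F | (d != 0) && is_sqr d]|.*2).+1 = q.
Proof.
have -> : q = (\sum_(d : F) num_sqrt d)%N.
  rewrite -sum1_card (partition_big (fun b : F => b ^+ 2) predT) //=.
  by apply: eq_bigr => d _; rewrite /num_sqrt -sum1_card; apply: eq_bigl => b; rewrite inE.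
rewrite (bigD1 0) //= num_sqrtE eqxx add1n; congr _.+1.
rewrite -muln2 -sum1_card big_distrl /= big_mkcond [RHS]big_mkcond /=.
apply: eq_bigr => d _; rewrite inE num_sqrtE.
by case: (d == 0) => //=; case: (is_sqr d).
Qed.

(** The case of two nonsquares is a count: the nonzero squares [S] and their multiples by the
    nonsquare [e] are disjoint and each fill half of the nonzero elements, so every nonsquare is [e]
    times a square. *)
Lemma is_sqr_div (d e : F) :
  d != 0 -> e != 0 -> is_sqr d = is_sqr e -> is_sqr (d / e).
Proof.
move=> d0 e0; case: (boolP (is_sqr d)) => [/existsP[b /eqP bd]|nd].
  move=> /esym/existsP[c /eqP ce]; apply/existsP; exists (b / c).
  by rewrite expr_div_n bd ce.
move=> /esym/negbT ne.
pose S := [set d : F | (d != 0) && is_sqr d].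
pose nS := [set x * e | x in S].
have cS : #|nS| = #|S| by rewrite card_imset //; exact: mulIf.
have dis : [disjoint S & nS].
  rewrite disjoint_sym disjoint_subset; apply/subsetP=> _ /imsetP[x xS ->].
  move: xS; rewrite !inE => /andP[x0 /existsP[b /eqP bx]].
  apply: contra ne => /andP[_ /existsP[c /eqP cx]].
  apply/existsP; exists (c / b); rewrite expr_div_n bx cx mulrC mulKf //.
have cov : S :|: nS = [set~ 0].
  apply/eqP; rewrite eqEcard; apply/andP; split.
    apply/subsetP=> y; rewrite !inE => /orP[/andP[]//|/imsetP[x]].
    by rewrite inE => /andP[x0 _] ->; rewrite mulf_neq0.
  have := cardsUI S nS; rewrite (disjoint_setI0 dis) cards0 addn0 => ->.
  rewrite cS; have := cardsC1 (0 : F); rewrite -card_sqr_nonzero /= -/S => ->.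
  by rewrite addnn.
have : d \in S :|: nS by rewrite cov !inE.
rewrite !inE d0 (negPf nd) /= => /imsetP[x].
by rewrite inE => /andP[_ sx] ->; rewrite mulfK.
Qed.

(** A nonzero first factor determines the second; a zero first factor is possible only for [v = 0]
    and then leaves the second free. *)
Lemma card_mul_eq (v : F) :
  #|[set p : F * F | p.1 * p.2 == v]| = (q.-1 + (v == 0%R) * q)%N.
Proof.
rewrite -sum1_card (partition_big (fun p : F * F => p.1) predT) //=.
rewrite (bigD1 0) //= addnC; congr (_ + _)%N.
  rewrite -(cardC1 (0 : F)) -sum1_card; apply: eq_bigr => b b0.
  rewrite (big_pred1 (b, v / b)) // => -[c d]; rewrite inE /= xpair_eqE andbC.
  case: eqP => //= ->; rewrite -(inj_eq (mulfI b0) d) mulrC.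
  by rewrite [b * (_ / _)]mulrC divfK // mulrC.
rewrite sum1_card; case: (eqVneq v 0) => [->|v0].
  rewrite mul1n -(card_imset predT (f := fun x : F => (0 : F, x))); last by move=> x y [].
  apply: eq_card => -[b c]; rewrite unfold_in inE /=.
  apply/andP/imsetP => [[_ /eqP ->]|[x _ [-> ->]]]; last by rewrite mul0r eqxx.
  by exists c.
rewrite mul0n; apply: eq_card0 => -[b c]; rewrite unfold_in inE /=.
by apply/negP => /andP[/eqP e /eqP b0]; move: v0; rewrite -e b0 mul0r eqxx.
Qed.

(** The discriminant of [X^2 - t X + 1], the characteristic polynomial of a matrix of trace [t] and
    determinant 1. *)
Definition disc (t : F) : F := t ^+ 2 - 4%:R.

(** Completing the square: [a] is a root of [X^2 - t X + 1] exactly when [2 a - t] is a square root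
    of the discriminant. *)
Lemma card_char_roots (t : F) :
  #|[set a : F | a * (t - a) - 1 == 0]| = num_sqrt (disc t).
Proof.
rewrite /num_sqrt.
have inj : injective (fun a : F => 2%:R * a - t) by move=> a b /addIr/(mulfI two_neq0).
rewrite -[RHS](on_card_preimset (onW_bij _ (injF_bij inj))).
apply: eq_card => a; rewrite !inE -[RHS]subr_eq0.
have -> : (2%:R * a - t) ^+ 2 - disc t = - 4%:R * (a * (t - a) - 1).
  by rewrite /disc; ring.
by rewrite mulf_eq0 oppr_eq0 (negPf four_neq0_odd_card).
Qed.

(** Double counting of the pairs of a trace [t] and a root [a]: a nonzero [a] is a root for the
    single trace [a^-1 + a], and 0 is never a root. *)
Lemma sum_num_sqrt_disc : (\sum_(t : F) num_sqrt (disc t))%N = q.-1.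
Proof.
under eq_bigr => t _ do rewrite -card_char_roots -sum1_card big_mkcond.
rewrite exchange_big (bigD1 0) //= big1 ?add0n => [|t _]; last first.
  by rewrite inE mul0r sub0r oppr_eq0 oner_eq0.
rewrite -(cardC1 (0 : F)) -sum1_card; apply: eq_bigr => a a0.
rewrite -big_mkcond (big_pred1 (a^-1 + a)) // => t; rewrite inE.
by rewrite subr_eq0 -(inj_eq (mulfI (invr_neq0 a0))) mulKf // mulr1 subr_eq.
Qed.

(* The traces [t] for which [X^2 - t X + 1] has two distinct roots, both in [F]
   ([e = true]) or none in [F] ([e = false]). *)
Definition reg_traces (e : bool) : {set F} :=
  [set t | (disc t != 0) && (is_sqr (disc t) == e)].

Lemma disc_eq0 (t : F) : (disc t == 0) = (t == 2%:R) || (t == - 2%:R).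
Proof. by rewrite /disc (natrM _ 2 2) -expr2 subr_eq0 eqf_sqr. Qed.

Lemma two_neq_opp : 2%:R != - 2%:R :> F.
Proof. exact: neq_opp. Qed.

Lemma card_disc0 : #|[set t : F | disc t == 0]| = 2%N.
Proof.
rewrite -[RHS](_ : #|[set (2%:R : F); - 2%:R]| = 2%N).
  by apply: eq_card => t; rewrite !inE disc_eq0.
by rewrite cards2 two_neq_opp.
Qed.

(** In the sum of [num_sqrt (disc t)], equal to [q - 1], the two traces of discriminant 0 give 1
    each, the split ones 2 and the others nothing. *)
Lemma card_reg_traces_split : (#|reg_traces true|.*2 + 3)%N = q.
Proof.
have q1 := finNzRing_gt1 F.
suff : (2 + #|reg_traces true|.*2)%N = q.-1 by lia.
rewrite -sum_num_sqrt_disc (bigID (fun t => disc t == 0)) /=.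
congr (_ + _)%N.
  by rewrite -[LHS]card_disc0 -sum1_card; apply: eq_big => [t|t]; rewrite ?inE // num_sqrtE => ->.
rewrite -muln2 -sum1_card big_distrl /= big_mkcond [RHS]big_mkcond /=.
apply: eq_bigr => t _; rewrite inE num_sqrtE.
by case: (disc t == 0) => //=; case: (is_sqr _).
Qed.

Lemma card_reg_traces_nonsplit : (#|reg_traces false|.*2 + 1)%N = q.
Proof.
suff : (2 + (#|reg_traces true| + #|reg_traces false|))%N = q.
  by have := card_reg_traces_split; lia.
rewrite -[RHS](cardsC [set t : F | disc t == 0]) card_disc0; congr (_ + _)%N.
rewrite -cardsUI (_ : _ :&: _ = set0) ?cards0 ?addn0; last first.
  by apply/setP=> t; rewrite !inE; case: (disc t == 0) => //=; case: (is_sqr _).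
by apply: eq_card => t; rewrite !inE; case: (disc t == 0) => //=; case: (is_sqr _).
Qed.

End FieldCounting.

(** * Two by two matrices *)

Section Matrices2.
Local Open Scope ring_scope.
Variable R : comNzRingType.
Implicit Types M N : 'M[R]_2.

Lemma mx2P M N :
  M 0 0 = N 0 0 -> M 0 1 = N 0 1 -> M 1 0 = N 1 0 -> M 1 1 = N 1 1 -> M = N.
Proof.
move=> e00 e01 e10 e11; apply/matrixP=> i j.
have I2 (k : 'I_2) : k = 0 \/ k = 1.
  by case: k => [[|[|//]] ?]; [left|right]; apply: val_inj.
by case: (I2 i) => ->; case: (I2 j) => ->.
Qed.

Lemma mulmx2 M N i j : (M *m N) i j = M i 0 * N 0 j + M i 1 * N 1 j.
Proof. by rewrite mxE big_ord_recl big_ord1; congr (_ + M i _ * N _ j); apply: val_inj. Qed.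

Lemma det_mx2 M : \det M = M 0 0 * M 1 1 - M 0 1 * M 1 0.
Proof.
rewrite (expand_det_row M 0) big_ord_recl big_ord1 /cofactor !det_mx11 !mxE /=.
rewrite (_ : lift 0 0 = 1) /=; last exact: val_inj.
rewrite (_ : lift 1 0 = 0) /=; last exact: val_inj.
by rewrite expr0 mul1r expr1 mulN1r mulrN.
Qed.

Lemma mxtrace2 M : \tr M = M 0 0 + M 1 1.
Proof. by rewrite /mxtrace big_ord_recl big_ord1; congr (_ + M _ _); apply: val_inj. Qed.

Lemma mx2_square M : M *m M = \tr M *: M - (\det M)%:M.
Proof.
by apply: mx2P; rewrite mulmx2 !mxE det_mx2 mxtrace2 /=; ring.
Qed.

Definition is_scalar2 M : bool := [&& M 0 1 == 0, M 1 0 == 0 & M 0 0 == M 1 1].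

Lemma is_scalar2P M : reflect (M = (M 0 0)%:M) (is_scalar2 M).
Proof.
apply: (iffP and3P) => [[/eqP e01 /eqP e10 /eqP e11]|eM].
  by apply: mx2P; rewrite !mxE ?e01 ?e10 ?e11.
by split; rewrite {}eM !mxE.
Qed.

Lemma is_scalar2_scalar (a : R) : is_scalar2 a%:M.
Proof. by rewrite /is_scalar2 !mxE /= !eqxx. Qed.

Definition mx2 (a b c d : R) : 'M[R]_2 :=
  \matrix_(i, j) (if i == 0 then if j == 0 then a else b
                  else if j == 0 then c else d).

End Matrices2.

(* Commuting with [M] forces the vectors [(M 0 1, M 1 0, M 0 0 - M 1 1)] of the
   two matrices to be proportional. *)
Lemma commute_nonscalar2 (F : fieldType) (M N : 'M[F]_2) :
  ~~ is_scalar2 M -> (M *m N = N *m M)%R ->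
  exists a b : F, N = (a%:M + b *: M)%R.
Proof.
move=> nsM /matrixP comMN.
have e00 : (M 0 1 * N 1 0 = N 0 1 * M 1 0)%R.
  have := comMN 0%R 0%R; rewrite !mulmx2 => e.
  by apply: (addrI (M 0 0 * N 0 0)%R); rewrite e; ring.
have e01 : ((N 0 0 - N 1 1) * M 0 1 = N 0 1 * (M 0 0 - M 1 1))%R.
  have := comMN 0%R 1%R; rewrite !mulmx2 => e.
  apply: (addIr (N 0 1 * M 1 1 + M 0 1 * N 1 1)%R).
  by transitivity (N 0 0 * M 0 1 + N 0 1 * M 1 1)%R; [|rewrite -e]; ring.
have e10 : ((N 0 0 - N 1 1) * M 1 0 = N 1 0 * (M 0 0 - M 1 1))%R.
  have := comMN 1%R 0%R; rewrite !mulmx2 => e.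
  apply: (addIr (N 1 1 * M 1 0 + N 1 0 * M 1 1)%R).
  by transitivity (N 1 0 * M 0 0 + N 1 1 * M 1 0)%R; [rewrite -e|]; ring.
suff [b [h01 h10 h11]] : exists b : F,
  [/\ N 0 1 = b * M 0 1, N 1 0 = b * M 1 0 & N 0 0 - N 1 1 = b * (M 0 0 - M 1 1)]%R.
  exists (N 0 0 - b * M 0 0)%R, b; apply: mx2P; rewrite !mxE /=.
  - ring.
  - by rewrite h01; ring.
  - by rewrite h10; ring.
  - have -> : N 1%R 1%R = (N 0 0 - (N 0 0 - N 1 1))%R by ring.
    by rewrite h11; ring.
case: (eqVneq (M 0 1)%R 0%R) => [m01|m01]; last first.
  exists (N 0 1 / M 0 1)%R; split; apply: (mulfI m01).
  - by field.
  - by rewrite e00; field.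
  - by rewrite mulrC e01; field.
case: (eqVneq (M 1 0)%R 0%R) => [m10|m10]; last first.
  exists (N 1 0 / M 1 0)%R; split; apply: (mulfI m10).
  - by rewrite mulrC -e00; field.
  - by field.
  - by rewrite mulrC e10; field.
have md : (M 0 0 - M 1 1 != 0)%R.
  by move: nsM; rewrite /is_scalar2 m01 m10 eqxx /= subr_eq0.
exists ((N 0 0 - N 1 1) / (M 0 0 - M 1 1))%R; split; apply: (mulfI md).
- by rewrite mulrC -e01; field.
- by rewrite mulrC -e10; field.
- by field.
Qed.

(** * Elements of SL_2 as two by two matrices *)

Section SL2.
Variable F : finFieldType.
Local Open Scope ring_scope.
Local Notation q := #|F|.
Local Notation G := (SL2_group F).
Implicit Types (g x y : {'GL_2[F]}) (M : 'M[F]_2).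

(** Fixes the matrix type as ['M[F]_2], whereas [GLval] returns the convertible ['M[F]_2.-1.+1]. *)
Definition GL2mx g : 'M[F]_2 := GLval g.

Lemma GL2mx_inj : injective GL2mx.
Proof. by move=> [M uM] [N uN] e; apply: val_inj. Qed.

Lemma GL2mxM x y : GL2mx (x * y)%g = GL2mx x *m GL2mx y.
Proof. by rewrite /GL2mx GL_MxE. Qed.

Lemma GL2mx1 : GL2mx 1%g = 1%:M.
Proof. by rewrite /GL2mx GL_1E. Qed.

Lemma in_SL2 g : (g \in G) = (\det (GL2mx g) == 1).
Proof. by rewrite inE. Qed.

Lemma SL2_det g : g \in G -> \det (GL2mx g) = 1.
Proof. by rewrite in_SL2 => /eqP. Qed.

(** A singular matrix is sent to the identity; the results below only apply this to matrices of
    determinant 1. *)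
Definition SL2_of_mx M : {'GL_2[F]} := insubd (1%g : {'GL_2[F]}) (M : 'M[F]_2.-1.+1).

Lemma SL2_of_mxK M : \det M = 1 -> GL2mx (SL2_of_mx M) = M.
Proof.
move=> dM; have uM : (M : 'M[F]_2.-1.+1) \is a GRing.unit.
  by have := unitmxE M; rewrite dM unitr1.
rewrite /SL2_of_mx /insubd insubT //.
Qed.

Lemma SL2_of_mx_in M : \det M = 1 -> SL2_of_mx M \in G.
Proof. by move=> dM; rewrite in_SL2 SL2_of_mxK ?dM. Qed.

Definition SL2_tr g : F := \tr (GL2mx g).
Definition central2 g : bool := is_scalar2 (GL2mx g).

Lemma SL2_trJ g x : SL2_tr (g ^ x)%g = SL2_tr g.
Proof.
by rewrite /SL2_tr conjgE GL2mxM mxtrace_mulC GL2mxM -mulmxA -GL2mxM mulgV GL2mx1 mulmx1.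
Qed.

End SL2.

(** * Traces and centralizers in SL_2 *)

Section SL2Counting.
Variable F : finFieldType.
Hypothesis q_odd : odd #|F|.
Local Open Scope ring_scope.
Local Notation q := #|F|.
Local Notation G := (SL2_group F).
Implicit Types (g x y : {'GL_2[F]}) (M : 'M[F]_2) (t s : F).
Let two_neq0 := two_neq0_odd_card q_odd.

(** A matrix with rows [(a, b)] and [(c, t - a)] has determinant 1 when [b c = a (t - a) - 1]. Each
    [a] gives [q - 1] pairs [(b, c)], and [q] more if the right side vanishes, that is, if [a] is a
    root of [X^2 - t X + 1]. *)
Lemma card_SL2_tr t :
  #|[set x in G | SL2_tr x == t]| = (q * q.-1 + q * num_sqrt (disc t))%N.
Proof.
pose S := [set p : F * (F * F) | p.2.1 * p.2.2 == p.1 * (t - p.1) - 1].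
pose f (p : F * (F * F)) := SL2_of_mx (mx2 p.1 p.2.1 p.2.2 (t - p.1)).
have fK p : p \in S -> GL2mx (f p) = mx2 p.1 p.2.1 p.2.2 (t - p.1).
  rewrite inE => /eqP e; rewrite SL2_of_mxK // det_mx2 !mxE /= e; ring.
rewrite (_ : [set x in G | _] = f @: S); last first.
  apply/setP=> x; rewrite !inE; apply/andP/imsetP => [[/eqP dx /eqP tx]|[p pS ->]].
    have pS : (GL2mx x 0 0, (GL2mx x 0 1, GL2mx x 1 0)) \in S.
      rewrite inE /= -tx /SL2_tr mxtrace2; apply/eqP.
      have : \det (GL2mx x) = 1 by exact: dx.
      by rewrite det_mx2 => <-; ring.
    exists (GL2mx x 0 0, (GL2mx x 0 1, GL2mx x 1 0)) => //.
    apply: GL2mx_inj; rewrite fK //.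
    by apply: mx2P; rewrite !mxE //= -tx /SL2_tr mxtrace2; ring.
  have dp : \det (GL2mx (f p)) = 1.
    by rewrite fK // det_mx2 !mxE /=; move: pS; rewrite inE => /eqP ->; ring.
  by rewrite -[\det _]/(\det (GL2mx (f p))) dp eqxx /SL2_tr mxtrace2 fK // !mxE /= subrKC.
rewrite card_in_imset => [|p p' pS p'S]; last first.
  move=> /(congr1 (@GL2mx F)); rewrite !fK // => /matrixP e.
  have := e 0 0; have := e 0 1; have := e 1 0; rewrite !mxE /=.
  by case: p p' {e pS p'S} => [a [b c]] [a' [b' c']] /= -> -> ->.
rewrite -sum1_card (partition_big (fun p : F * (F * F) => p.1) predT) //=.
transitivity (\sum_(a : F) (q.-1 + (a * (t - a) - 1 == 0)%R * q))%N.
  apply: eq_bigr => a _; rewrite -card_mul_eq sum1_card.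
  rewrite -(card_imset _ (f := fun x : F * F => (a, x))); last by move=> x y [].
  apply: eq_card => -[b c]; rewrite unfold_in inE /=.
  apply/andP/imsetP => [[e /eqP ba]|[x xS [-> ->]]].
    by exists c; rewrite ?inE -ba.
  by move: xS; rewrite inE.
rewrite big_split /= sum_nat_const; congr (_ + _)%N.
rewrite -card_char_roots // -sum1_card big_distrr /= [RHS]big_mkcond /=.
by apply: eq_bigr => a _; rewrite inE; case: (_ == 0); rewrite ?muln1 ?mul1n.
Qed.

Lemma card_SL2 : #|G| = (q * q.-1 * q.+1)%N.
Proof.
rewrite -sum1_card (partition_big (@SL2_tr F) predT) //=.
transitivity (\sum_(t : F) (q * q.-1 + q * num_sqrt (disc t)))%N.
  apply: eq_bigr => t _; rewrite -card_SL2_tr -sum1_card.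
  by apply: eq_bigl => x; rewrite !inE.
rewrite big_split /= sum_nat_const -big_distrr /= sum_num_sqrt_disc //.
by rewrite [RHS]mulnS addnC; congr (_ + _)%N; apply: mulnC.
Qed.

Lemma mxtrace_lin_mx2 (a b : F) M :
  \tr (a%:M + b *: M) = 2%:R * a + b * \tr M.
Proof. by rewrite !mxtrace2 !mxE /=; ring. Qed.

Lemma det_lin_mx2 (a b : F) M :
  \det (a%:M + b *: M) = a ^+ 2 + a * b * \tr M + b ^+ 2 * \det M.
Proof. by rewrite !det_mx2 !mxtrace2 !mxE /=; ring. Qed.

Lemma lin_mx2_inj (a b a' b' : F) M : ~~ is_scalar2 M ->
  a%:M + b *: M = a'%:M + b' *: M -> a = a' /\ b = b'.
Proof.
move=> nsM /matrixP e; suff bb : b = b'.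
  by split=> //; have := e 0 0; rewrite !mxE /= bb => /addIr; rewrite !mulr1n.
have e00 := e 0 0; have e01 := e 0 1; have e10 := e 1 0; have e11 := e 1 1.
move: e00 e01 e10 e11; rewrite !mxE /= !mulr1n !add0r => e00 e01 e10 e11.
move: nsM; rewrite /is_scalar2.
case: (eqVneq (M 0 1) 0) => [_|m]; last by move: (mulIf m e01).
case: (eqVneq (M 1 0) 0) => [_|m]; last by move: (mulIf m e10).
rewrite /= -subr_eq0 => m; apply: (mulIf m).
transitivity ((a + b * M 0 0) - (a + b * M 1 1)); first ring.
by rewrite e00 e11; ring.
Qed.

(* Over the centralizer of [g], the elements [a + b g] of trace [s] are
   parametrized by the solutions [b] of [b^2 disc (tr g) = disc s]. *)
Lemma card_cent_tr g s : g \in G -> ~~ central2 g ->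
  #|[set x in 'C_G[g]%g | SL2_tr x == s]|
    = #|[set b : F | b ^+ 2 * disc (SL2_tr g) == disc s]|.
Proof.
move=> gG nsg; set t := SL2_tr g.
(* The trace of [a + b g] is [2 a + b t], so trace [s] leaves only this [a]; four times the
   determinant is then [s ^+ 2 - b ^+ 2 * disc t]. *)
pose a b := (s - b * t) / 2%:R.
pose f b := SL2_of_mx ((a b)%:M + b *: GL2mx g).
have df b : b ^+ 2 * disc t = disc s -> \det ((a b)%:M + b *: GL2mx g) = 1.
  move=> e; rewrite det_lin_mx2 SL2_det // -/(SL2_tr g) -/t /a.
  apply: (mulfI (four_neq0_odd_card q_odd)).
  transitivity (s ^+ 2 - b ^+ 2 * disc t); first by rewrite /disc; field.
  by rewrite e /disc; ring.
have fK b : b ^+ 2 * disc t = disc s -> GL2mx (f b) = (a b)%:M + b *: GL2mx g.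
  by move=> e; rewrite SL2_of_mxK ?df.
rewrite -(card_in_imset (f := f)) => [|b b']; last first.
  rewrite !inE => /eqP e /eqP e' /(congr1 (@GL2mx F)); rewrite !fK //.
  by move=> /(lin_mx2_inj nsg)[].
apply: eq_card => x; apply/idP/imsetP => [|[b]]; last first.
  rewrite inE => /eqP e ->; rewrite inE; apply/andP; split; last first.
    by rewrite /SL2_tr fK // mxtrace_lin_mx2 -/(SL2_tr g) -/t /a; apply/eqP; field.
  apply/setIP; split; first by rewrite in_SL2 fK // df.
  apply/cent1P/GL2mx_inj; rewrite !GL2mxM fK //.
  by rewrite mulmxDl mulmxDr scalar_mxC -scalemxAl -scalemxAr.
rewrite inE => /andP[/setIP[xG /cent1P xg] /eqP tx].
have [a' [b xE]] : exists a b : F, GL2mx x = a%:M + b *: GL2mx g.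
  have := congr1 (@GL2mx F) xg; rewrite !GL2mxM => xg_mx.
  exact: commute_nonscalar2 nsg (esym xg_mx).
have a'E : a' = a b.
  apply: (mulIf two_neq0); rewrite /a [RHS]divfK // mulrC.
  by rewrite -tx /SL2_tr xE mxtrace_lin_mx2 -/(SL2_tr g) -/t; ring.
have b_s : b ^+ 2 * disc t = disc s.
  have := SL2_det xG; rewrite xE det_lin_mx2 SL2_det // -/(SL2_tr g) -/t a'E /a => e.
  apply/eqP; rewrite -subr_eq0 -oppr_eq0; apply/eqP.
  transitivity (4%:R * (((s - b * t) / 2%:R) ^+ 2 +
      (s - b * t) / 2%:R * b * t + b ^+ 2 * 1 - 1)); last by rewrite e; ring.
  by rewrite /disc; field.
by exists b; rewrite ?inE ?b_s //; apply: GL2mx_inj; rewrite fK // xE a'E.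
Qed.

End SL2Counting.

(** * Orders of centralizers, and traces that form one class *)

Section Tori.
Variable F : finFieldType.
Hypothesis q_odd : odd #|F|.
Local Open Scope ring_scope.
Local Notation q := #|F|.
Local Notation G := (SL2_group F).
Implicit Types (g x y : {'GL_2[F]}) (M : 'M[F]_2) (t s : F) (e : bool).
Let two_neq0 := two_neq0_odd_card q_odd.

Lemma central2P x : x \in G ->
  reflect (exists2 a : F, a ^+ 2 = 1 & GL2mx x = a%:M) (central2 x).
Proof.
move=> xG; apply: (iffP idP) => [/is_scalar2P xE|[a _]]; last first.
  by rewrite /central2 => ->; exact: is_scalar2_scalar.
exists (GL2mx x 0 0) => //.
by rewrite -(SL2_det xG) [in RHS]xE det_scalar.
Qed.

Lemma central2_disc x : x \in G -> central2 x -> disc (SL2_tr x) = 0.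
Proof.
move=> xG /(central2P xG)[a a1 xE].
rewrite /SL2_tr xE mxtrace_scalar /disc.
by transitivity (4%:R * (a ^+ 2 - 1)); [ring | rewrite a1 subrr mulr0].
Qed.

Lemma disc_nonscalar x : x \in G -> disc (SL2_tr x) != 0 -> ~~ central2 x.
Proof. by move=> xG; apply: contra => /(central2_disc xG) ->. Qed.

Lemma reg_traces_disc e t : t \in reg_traces F e -> disc t != 0.
Proof. by rewrite inE => /andP[]. Qed.

Lemma card_cent g : g \in G -> ~~ central2 g ->
  #|'C_G[g]%g| =
    (\sum_s #|[set b : F | (b ^+ 2 * disc (SL2_tr g) == disc s)%R]|)%N.
Proof.
move=> gG nsg; rewrite -sum1_card (partition_big (@SL2_tr F) predT) //=.
apply: eq_bigr => s _; rewrite -card_cent_tr // -sum1_card.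
by apply: eq_bigl => x; rewrite [in RHS]inE.
Qed.

(** Here [b ^+ 2 * disc (SL2_tr g) = disc s] no longer depends on [b]: all [q] values of [b] occur
    for the two [s] of discriminant 0, and none for other [s]. *)
Lemma card_cent_unipotent g : g \in G -> ~~ central2 g ->
  disc (SL2_tr g) = 0 -> #|'C_G[g]%g| = (2 * q)%N.
Proof.
move=> gG nsg dg; rewrite card_cent // dg -(card_disc0 q_odd).
rewrite -sum1_card big_distrl /= [RHS]big_mkcond /=; apply: eq_bigr => s _.
rewrite inE mul1n -cardsT; case: ifP => d0.
  by apply: eq_card => b; rewrite !inE mulr0 eq_sym d0.
by apply: eq_card0 => b; rewrite !inE mulr0 eq_sym d0.
Qed.

(** The equation becomes [b ^+ 2 = disc s / disc (SL2_tr g)]: its only solution is 0 if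
    [disc s = 0], and otherwise there are two solutions or none, according to whether the
    discriminants agree modulo squares. *)
Lemma card_cent_reg_tr e g s : g \in G -> SL2_tr g \in reg_traces F e ->
  #|[set x in 'C_G[g]%g | SL2_tr x == s]| =
    if disc s == 0 then 1%N else (s \in reg_traces F e).*2.
Proof.
move=> gG ge; have dg := reg_traces_disc ge.
rewrite card_cent_tr ?disc_nonscalar //.
rewrite (_ : #|_| = num_sqrt (disc s / disc (SL2_tr g))); last first.
  apply: eq_card => b; rewrite !inE -[in RHS](inj_eq (mulIf dg)) divfK //.
rewrite num_sqrtE // mulf_eq0 invr_eq0 (negPf dg) orbF.
case: (eqVneq (disc s) 0) => // ds; congr (nat_of_bool _).*2.
move: ge; rewrite !inE ds dg /= => /eqP ge.
apply/idP/eqP => [sq|se]; last by apply: is_sqr_div => //; rewrite se.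
apply/idP/idP; rewrite -?ge.
  move=> /existsP[b /eqP bE]; case/existsP: sq => c /eqP cE.
  apply/existsP; exists (b / c); rewrite expr_div_n bE cE.
  by rewrite invf_div mulrC divfK.
move=> /existsP[b /eqP bE]; case/existsP: sq => c /eqP cE.
by apply/existsP; exists (b * c); rewrite exprMn bE cE mulrC divfK.
Qed.

Definition torus_order e : nat := if e then q.-1 else q.+1.

Lemma card_reg_tracesE e : (2 + #|reg_traces F e|.*2)%N = torus_order e.
Proof.
case: e; rewrite /torus_order.
  by have := card_reg_traces_split q_odd; lia.
by have := card_reg_traces_nonsplit q_odd; lia.
Qed.

Lemma card_torus e g : g \in G -> SL2_tr g \in reg_traces F e ->
  #|'C_G[g]%g| = torus_order e.
Proof.
move=> gG ge; rewrite -card_reg_tracesE -sum1_card.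
rewrite (partition_big (@SL2_tr F) predT) //=.
transitivity (\sum_(s : F) if disc s == 0%R then 1 else (s \in reg_traces F e).*2)%N.
  apply: eq_bigr => s _; rewrite -(card_cent_reg_tr s gG ge) -sum1_card.
  by apply: eq_bigl => x; rewrite [in RHS]inE.
rewrite (bigID (fun s : F => disc s == 0)) /= -[2%N](card_disc0 q_odd).
congr (_ + _)%N.
  by rewrite -sum1_card; apply: eq_big => s; rewrite ?inE // => ->.
rewrite -muln2 -sum1_card big_distrl /= big_mkcond [RHS]big_mkcond /=.
apply: eq_bigr => s _; case: (boolP (s \in _)) => [/reg_traces_disc ds|_].
  by rewrite (negPf ds).
by case: ifP => //= /negPf ->.
Qed.

Lemma card_reg_SL2_tr e t : t \in reg_traces F e ->
  (#|[set x in G | SL2_tr x == t]| * torus_order e)%N = #|G|.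
Proof.
move=> te; rewrite card_SL2_tr // card_SL2 // num_sqrtE //.
rewrite (negPf (reg_traces_disc te)).
move: te; rewrite inE => /andP[_ /eqP ->].
by rewrite /torus_order; case: e; case: q => [|q1] /=; nia.
Qed.

(** The class of [g] lies in the fibre of its trace. Both sets have cardinal [#|G|] divided by the
    torus order, the class by orbit counting and the fibre by [card_reg_SL2_tr], so they
    coincide. *)
Lemma reg_trace_class e g x : g \in G -> x \in G -> 
  SL2_tr g \in reg_traces F e -> SL2_tr x = SL2_tr g -> x \in (g ^: G)%g.
Proof.
move=> gG xG ge xg.
have sub : (g ^: G)%g \subset [set x in G | SL2_tr x == SL2_tr g].
  apply/subsetP=> _ /imsetP[y yG ->].
  by rewrite inE SL2_trJ groupJ ?eqxx.
suff /eqP -> : (g ^: G)%g == [set x in G | SL2_tr x == SL2_tr g].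
  by rewrite inE xG xg eqxx.
rewrite eqEcard sub /= -(leq_pmul2r (cardG_gt0 'C_G[g]%G)) /=.
rewrite {1}(card_torus gG ge) card_reg_SL2_tr // -index_cent1 mulnC.
by rewrite Lagrange ?subsetIl.
Qed.

(** By the count per trace, a trace of the other type does not occur in the centralizer, and a trace
    [s] of discriminant 0 occurs once. The scalar [s / 2] already accounts for that one occurrence,
    so an element of such a trace is central. *)
Lemma torus_of_mem e g x : g \in G -> SL2_tr g \in reg_traces F e ->
  x \in 'C_G[g]%g -> ~~ central2 x -> SL2_tr x \in reg_traces F e.
Proof.
move=> gG ge xC nsx; have /setIP[xG _] := xC.
have := card_cent_reg_tr (SL2_tr x) gG ge.
case: (boolP (SL2_tr x \in _)) => // _.
case: ifP => [|_ /= /eqP]; last first.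
  by rewrite cards_eq0 => /eqP/setP/(_ x); rewrite in_set0 inE xC eqxx.
move=> d0 /eqP/cards1P[y yE].
(* This scalar has trace [s] and, since [s ^+ 2 = 4], determinant 1. *)
pose z := SL2_of_mx ((SL2_tr x / 2%:R)%:M : 'M[F]_2).
have dz : \det ((SL2_tr x / 2%:R)%:M : 'M[F]_2) = 1.
  rewrite det_scalar expr_div_n; move: d0; rewrite /disc subr_eq0 => /eqP ->.
  by rewrite (natrM _ 2 2) -expr2 divff ?expf_neq0.
have : z \in [set y].
  rewrite -yE inE; apply/andP; split.
    apply/setIP; split; first exact: SL2_of_mx_in.
    by apply/cent1P/GL2mx_inj; rewrite !GL2mxM SL2_of_mxK // scalar_mxC.
  by rewrite /SL2_tr SL2_of_mxK // mxtrace_scalar -[_ *+ 2]mulr_natr divfK.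
have : x \in [set y] by rewrite -yE inE xC eqxx.
rewrite !inE => /eqP xy /eqP zy; case/negP: nsx.
by rewrite /central2 xy -zy SL2_of_mxK // is_scalar2_scalar.
Qed.

End Tori.

(** * Powers in tori *)

Lemma mem_nth_powers (gT : finGroupType) n (A : {set gT}) x :
  x \in A -> (x ^+ n)%g \in nth_powers n A.
Proof. exact: (imset_f (fun x => x ^+ n)%g). Qed.

Lemma nth_powers1 (gT : finGroupType) n (H : {group gT}) : 1%g \in nth_powers n H.
Proof. by rewrite -(expg1n _ n) mem_nth_powers. Qed.

Lemma nth_powers_sub (gT : finGroupType) n (H : {group gT}) :
  nth_powers n H \subset H.
Proof. by apply/subsetP=> _ /imsetP[x xH ->]; rewrite groupX. Qed.

Lemma nth_powersJ (gT : finGroupType) n (H : {group gT}) x y :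
  x \in nth_powers n H -> y \in H -> (x ^ y)%g \in nth_powers n H.
Proof.
by move=> /imsetP[z zH ->] yH; rewrite conjXg mem_nth_powers // groupJ.
Qed.

Lemma card_nth_powers_cyclic (gT : finGroupType) (T : {group gT}) n :
  cyclic T ->
  exists2 H : {group gT}, nth_powers n T = H & #|H| = (#|T| %/ gcdn #|T| n)%N.
Proof.
move=> /cyclicP[y Ty]; exists <[(y ^+ n)%g]>%G; last by rewrite -orderE orderXgcd Ty.
apply/setP=> x; rewrite Ty; apply/imsetP/cycleP => [[z /cycleP[i ->] ->]|[i ->]].
  by exists i; rewrite -!expgM mulnC.
by exists (y ^+ i)%g; rewrite ?mem_cycle // -!expgM mulnC.
Qed.

Section TorusPowers.
Variable F : finFieldType.
Hypothesis q_odd : odd #|F|.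
Local Open Scope ring_scope.
Local Notation q := #|F|.
Local Notation G := (SL2_group F).
Implicit Types (g x y : {'GL_2[F]}) (M : 'M[F]_2) (t s : F) (e : bool).
Let two_neq0 := two_neq0_odd_card q_odd.

(** Over the splitting field of the characteristic polynomial an eigenvector exists whether or not
    the eigenvalues lie in [F]. *)
Lemma eigenvalue_extension M :
  exists (L : fieldType) (f : {rmorphism F -> L}) (z : L) (v : 'rV[L]_2),
    v != 0 /\ v *m map_mx f M = z *: v.
Proof.
have p0 : char_poly M != 0 by rewrite monic_neq0 // char_poly_monic.
have [L [rs pE _]] := FinSplittingFieldFor p0.
have : size (map_poly (GRing.in_alg L) (char_poly M)) = 3%N.
  by rewrite size_map_poly size_char_poly.
rewrite (eqp_size pE) size_prod_XsubC; case: rs pE => [//|z rs] pE _.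
have : eigenvalue (map_mx (GRing.in_alg L) M) z.
  rewrite eigenvalue_root_char -map_char_poly (eqp_root pE).
  by rewrite root_prod_XsubC inE eqxx.
by case/eigenvalueP=> v vz v0; exists L, (GRing.in_alg L), z, v.
Qed.

Lemma torus_elt g x : g \in G -> ~~ central2 g -> x \in 'C_G[g]%g ->
  exists a b : F, GL2mx x = a%:M + b *: GL2mx g /\
                  a ^+ 2 + a * b * SL2_tr g + b ^+ 2 = 1.
Proof.
move=> gG nsg /setIP[xG /cent1P xg].
have [a [b xE]] : exists a b : F, GL2mx x = a%:M + b *: GL2mx g.
  have := congr1 (@GL2mx F) xg; rewrite !GL2mxM => xg_mx.
  exact: commute_nonscalar2 nsg (esym xg_mx).
exists a, b; split=> //.
by have := SL2_det xG; rewrite xE det_lin_mx2 (SL2_det gG) mulr1.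
Qed.

(** Every element [a + b g] of the centralizer acts on the eigenvector [v] of [g] by the scalar
    [a + b z]. This embeds the centralizer in the multiplicative group of a field, where finite
    subgroups are cyclic. *)
Lemma torus_cyclic g : g \in G -> disc (SL2_tr g) != 0 -> cyclic 'C_G[g]%g.
Proof.
move=> gG dg; have nsg := disc_nonscalar gG dg.
have [L [f [z [v [v0 vg]]]]] := eigenvalue_extension (GL2mx g).
have [j vj] : exists j, v 0 j != 0 by apply/rV0Pn.
have [u uE] : exists u : L, u = f (SL2_tr g) by eexists.
have z_root : z ^+ 2 = u * z - 1.
  have : v *m map_mx f (GL2mx g *m GL2mx g) = (u * z - 1) *: v.
    rewrite mx2_square (SL2_det gG) map_mxB map_mxZ map_mx1 -/(SL2_tr g) -uE.
    by rewrite mulmxBr -scalemxAr vg mulmx1 scalerA scalerBl scale1r.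
  rewrite map_mxM mulmxA vg -scalemxAl vg scalerA -expr2.
  by move=> /matrixP/(_ 0 j); rewrite !mxE => /(mulIf vj).
have act a b : v *m map_mx f (a%:M + b *: GL2mx g) = (f a + f b * z) *: v.
  rewrite map_mxD map_mxZ map_scalar_mx mulmxDr mul_mx_scalar -scalemxAr vg.
  by rewrite scalerA scalerDl.
(* The eigenvalue is read off at a coordinate [j] where [v] does not vanish. *)
pose h x := (v *m map_mx f (GL2mx x)) 0 j / v 0 j.
have hab x a b : GL2mx x = a%:M + b *: GL2mx g -> h x = f a + f b * z.
  by move=> xE; rewrite /h xE act mxE mulfK.
have hv x : x \in 'C_G[g]%g -> v *m map_mx f (GL2mx x) = h x *: v.
  by move=> /(torus_elt gG nsg)[a [b [xE _]]]; rewrite (hab _ _ _ xE) xE act.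
apply: (@field_mul_group_cyclic _ ('C_G[g])%G _ h) => [x y xC yC|x xC].
  rewrite {1}/h GL2mxM map_mxM mulmxA (hv x xC) -scalemxAl (hv y yC) !mxE.
  by rewrite mulrA mulfK.
split=> [|->]; last by rewrite /h GL2mx1 map_mx1 mulmx1 divff.
have [a [b [xE]]] := torus_elt gG nsg xC.
rewrite (hab _ _ _ xE) => /(congr1 f).
rewrite !(rmorphD, rmorphM, rmorphXn) rmorph1 /= -uE => N1 h1.
(* Injectivity: an eigenvalue 1 means [a = 1 - b z], and inserting this into the determinant
   equation leaves [b (u - 2 z) = 0]. The second factor is nonzero, because its square is the
   discriminant. *)
have bt : f b * (u - 2%:R * z) = 0.
  have aE : f a = 1 - f b * z by rewrite -h1 addrK.
  transitivity ((f a ^+ 2 + f a * f b * u + f b ^+ 2 - 1)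
     - f b ^+ 2 * (z ^+ 2 - (u * z - 1))); first by rewrite aE; ring.
  by rewrite N1 z_root; ring.
have tz : u - 2%:R * z != 0.
  rewrite -sqrf_eq0 (_ : _ ^+ 2 = f (disc (SL2_tr g))) ?fmorph_eq0 //.
  rewrite /disc rmorphB rmorphXn /= -uE rmorph_nat.
  transitivity (u ^+ 2 - 4%:R * u * z + 4%:R * z ^+ 2); first ring.
  by rewrite z_root; ring.
have b0 : b = 0.
  by apply/eqP; rewrite -(fmorph_eq0 f); move/eqP: bt; rewrite mulf_eq0 (negPf tz) orbF.
apply: GL2mx_inj; rewrite xE GL2mx1 b0 scale0r addr0; congr _%:M.
by apply: (fmorph_inj f); rewrite rmorph1 -h1 b0 rmorph0 mul0r addr0.
Qed.

Definition SL2_neg1 : {'GL_2[F]} := SL2_of_mx (- 1)%:M.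

Lemma SL2_neg1E : GL2mx SL2_neg1 = (- 1)%:M.
Proof. by rewrite SL2_of_mxK // det_scalar sqrrN expr1n. Qed.

Lemma SL2_neg1_in : SL2_neg1 \in G.
Proof. by rewrite in_SL2 SL2_neg1E det_scalar sqrrN expr1n. Qed.

Lemma SL2_neg1_neq1 : SL2_neg1 != 1%g.
Proof.
apply/eqP=> /(congr1 (@GL2mx F)); rewrite SL2_neg1E GL2mx1 => /matrixP/(_ 0 0).
rewrite !mxE /= !mulr1n => /eqP; rewrite eq_sym -addr_eq0 -mulr2n.
by rewrite (negPf two_neq0).
Qed.

Lemma central2E x : x \in G -> central2 x = (x == 1%g) || (x == SL2_neg1).
Proof.
move=> xG; apply/idP/orP => [/(central2P xG)[a /eqP]|[] /eqP ->].
- rewrite -subr_eq0 subr_sqr_1 mulf_eq0 subr_eq0 addr_eq0 => /orP[] /eqP -> xE; [left|right].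
    by apply/eqP/GL2mx_inj; rewrite xE GL2mx1.
  by apply/eqP/GL2mx_inj; rewrite xE SL2_neg1E.
- by rewrite /central2 GL2mx1 is_scalar2_scalar.
- by rewrite /central2 SL2_neg1E is_scalar2_scalar.
Qed.

Lemma card_central2 (A : {set {'GL_2[F]}}) : A \subset G -> 1%g \in A ->
  #|A :&: [set x | central2 x]| = (1 + (SL2_neg1 \in A))%N.
Proof.
move=> AG A1; rewrite (cardsD1 1%g) !inE A1 /central2 GL2mx1 is_scalar2_scalar.
congr (1 + _)%N; case: (boolP (SL2_neg1 \in A)) => nA.
  rewrite (_ : _ :\ _ = [set SL2_neg1]) ?cards1 //; apply/setP=> x.
  rewrite !inE; case: (eqVneq x SL2_neg1) => [->|xn].
    by rewrite SL2_neg1_neq1 nA /= SL2_neg1E is_scalar2_scalar.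
  apply/negP=> /and3P[x1 xA]; rewrite -/(central2 x) central2E ?(negPf x1) ?(negPf xn) //.
  exact: subsetP AG _ xA.
apply: eq_card0 => x; rewrite !inE; apply/negP=> /and3P[x1 xA].
rewrite -/(central2 x) central2E; last exact: subsetP AG _ xA.
by rewrite (negPf x1) /= => /eqP xn; rewrite -xn xA in nA.
Qed.

Lemma SL2_neg1_sqr : (SL2_neg1 ^+ 2 = 1)%g.
Proof.
apply: GL2mx_inj; rewrite expgS expg1 GL2mxM SL2_neg1E -scalar_mxM GL2mx1.
by rewrite mulrNN mulr1.
Qed.

(** By Cayley-Hamilton [x ^+ 2 = 1] reads [tr x * x = 2]. As 2 is nonzero, so is the trace, and [x]
    is scalar. Hence -1 is the only involution. *)
Lemma SL2_sqr_eq1 x : x \in G -> (x ^+ 2 = 1)%g -> central2 x.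
Proof.
move=> xG /(congr1 (@GL2mx F)); rewrite expgS expg1 GL2mxM GL2mx1 mx2_square.
rewrite (SL2_det xG) => /eqP; rewrite subr_eq -/(SL2_tr x) => /eqP xE.
case: (eqVneq (SL2_tr x) 0) => [t0|t0].
  move/matrixP/(_ 0 0): xE; rewrite t0 scale0r !mxE /= => /eqP.
  by rewrite eq_sym -mulr2n (negPf two_neq0).
rewrite /central2 -[GL2mx x]scale1r -(mulVf t0) -scalerA xE -raddfD /=.
by rewrite scale_scalar_mx is_scalar2_scalar.
Qed.

(** As -1 is the only involution of SL_2, Cauchy's theorem turns membership of -1 into parity of the
    order. *)
Lemma SL2_neg1_in_group (H : {group {'GL_2[F]}}) : H \subset G ->
  (SL2_neg1 \in H) = (2 %| #|H|)%N.
Proof.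
move=> HG; apply/idP/idP => [h|].
  have o2 : #[SL2_neg1]%g = 2%N.
    exact: nt_prime_order (isT : prime 2) SL2_neg1_sqr SL2_neg1_neq1.
  by have := order_dvdG h; rewrite o2.
case/Cauchy=> // x xH ox; have xG := subsetP HG x xH.
have x2 : (x ^+ 2 = 1)%g by have := expg_order x; rewrite ox.
have := SL2_sqr_eq1 xG x2; rewrite central2E // -order_eq1 ox /=.
by move=> /eqP <-.
Qed.

Variable n : nat.

(** The order of the subgroup of n-th powers of a cyclic group of order [torus_order F e]; it makes
    sense even if no trace has type [e]. *)
Definition torus_powers e : nat := (torus_order F e %/ gcdn (torus_order F e) n)%N.

Definition power_traces e : {set F} :=
  [set t in reg_traces F e | [exists x in nth_powers n G, SL2_tr x == t]].

Lemma SL2_of_tr t : exists2 g, g \in G & SL2_tr g = t.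
Proof.
(* The companion matrix of [X^2 - t X + 1]. *)
have d1 : \det (mx2 0 (- 1) 1 t) = 1 by rewrite det_mx2 !mxE /=; ring.
exists (SL2_of_mx (mx2 0 (- 1) 1 t)); first exact: SL2_of_mx_in.
by rewrite /SL2_tr SL2_of_mxK // mxtrace2 !mxE /= add0r.
Qed.

(** A root [y] of [x] need only commute with [x] a priori. But [x] is noncentral in the torus, so
    its own centralizer is cyclic, hence abelian; it contains both [y] and [g], which therefore
    commute. *)
Lemma torus_nth_power e g x : g \in G -> SL2_tr g \in reg_traces F e ->
  x \in 'C_G[g]%g -> ~~ central2 x ->
  (x \in nth_powers n 'C_G[g]%g) = (x \in nth_powers n G).
Proof.
move=> gG ge xC nsx; apply/idP/idP => /imsetP[y yC xE].
  by rewrite xE mem_nth_powers //; case/setIP: yC.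
rewrite xE mem_nth_powers // inE yC /=; have [xG /cent1P xg] := setIP xC.
have xy : y \in 'C_G[x]%g.
  by rewrite inE yC; apply/cent1P; rewrite xE; exact: commuteX.
have gx : g \in 'C_G[x]%g by rewrite inE gG cent1C; apply/cent1P.
have cyc := torus_cyclic xG (reg_traces_disc (torus_of_mem q_odd gG ge xC nsx)).
by apply/cent1P; apply: (centsP (cyclic_abelian cyc)).
Qed.

Lemma reg_trace_nth_power e x : x \in G -> SL2_tr x \in reg_traces F e ->
  (x \in nth_powers n G) = (SL2_tr x \in power_traces e).
Proof.
move=> xG xe; rewrite inE xe /=; apply/idP/exists_inP => [xP|[y yP /eqP yx]].
  by exists x.
have yG := subsetP (nth_powers_sub n G) y yP.
have : x \in (y ^: G)%g by apply: (reg_trace_class q_odd (e := e)); rewrite ?yx.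
by case/imsetP=> z zG ->; apply: nth_powersJ.
Qed.

Lemma torus_powers_reg e g : g \in G -> SL2_tr g \in reg_traces F e ->
  [/\ #|nth_powers n 'C_G[g]%g| = torus_powers e &
      (SL2_neg1 \in nth_powers n 'C_G[g]%g) = (2 %| torus_powers e)%N].
Proof.
move=> gG ge; have dg := reg_traces_disc ge.
have [H HE cH] := card_nth_powers_cyclic n (torus_cyclic gG dg).
have HG : H \subset G.
  by rewrite -HE (subset_trans (nth_powers_sub _ _)) ?subsetIl.
by rewrite /torus_powers -(card_torus q_odd gG ge) -cH HE SL2_neg1_in_group.
Qed.

(** The subgroup of n-th powers of a torus consists of 1, possibly -1, and two elements for each
    trace of a noncentral power; -1 is present when the order is even. *)
Lemma card_power_traces e :
  (#|power_traces e|.*2 + 1 + (2 %| torus_powers e))%N = torus_powers e.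
Proof.
case: (set_0Vmem (reg_traces F e)) => [K0|[t te]].
  (* Without traces of type [e] (the split type for [q = 3]) no [g] is available, but the torus
     order is then 2 and [gcdn 2 n] is 1 or 2, so the formula is checked directly. *)
  have := card_reg_tracesE q_odd e; rewrite K0 cards0 /torus_powers => <-.
  rewrite (_ : power_traces e = set0) ?cards0; last first.
    by apply/setP=> t; rewrite inE K0 !inE.
  have : (gcdn 2 n <= 2)%N by apply: dvdn_leq => //; apply: dvdn_gcdl.
  have : (0 < gcdn 2 n)%N by rewrite gcdn_gt0.
  by case: (gcdn 2 n) => [|[|[|]]].
have [g gG gt] := SL2_of_tr t; rewrite -gt in te.
have dg := reg_traces_disc te; have nsg := disc_nonscalar gG dg.
have [cT negT] := torus_powers_reg gG te; rewrite -{2}cT -negT.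
set T := ('C_G[g])%g in cT negT *; set P := nth_powers n T.
have PT : P \subset T by exact: nth_powers_sub.
have TG : T \subset G by exact: subsetIl.
have cZ : #|P :&: [set x | central2 x]| = (1 + (SL2_neg1 \in P))%N.
  exact: card_central2 (subset_trans PT TG) (nth_powers1 n _).
have cR : #|P :\: [set x | central2 x]| = (#|power_traces e|.*2)%N.
  have memP x : (x \in P :\: [set x | central2 x]) = (x \in P) && ~~ central2 x.
    by rewrite inE inE andbC.
  rewrite -[LHS]sum1_card.
  rewrite (partition_big (@SL2_tr F) (mem (reg_traces F e))) /= => [|x]; last first.
    rewrite memP => /andP[/(subsetP PT) xT nsx].
    exact: (torus_of_mem q_odd gG te).
  rewrite -muln2 -[in RHS]sum1_card big_distrl /= [RHS]big_mkcond [LHS]big_mkcond /=.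
  apply: eq_bigr => t' _; case: ifP => t'e; last by rewrite inE t'e.
  have dt' := reg_traces_disc t'e.
  case: ifP => t'P.
    rewrite -[RHS](_ : #|[set x in T | SL2_tr x == t']| = _); last first.
      by rewrite (card_cent_reg_tr q_odd _ gG te) t'e (negPf dt').
    rewrite -sum1_card; apply: eq_bigl => x; rewrite memP [RHS]inE.
    case: (eqVneq (SL2_tr x) t') => [xt|]; rewrite ?andbF // !andbT.
    case: (boolP (x \in T)) => xT; last first.
      by apply/negP=> /andP[/(subsetP PT)]; rewrite (negPf xT).
    have xG := subsetP TG _ xT.
    have nsx : ~~ central2 x by rewrite disc_nonscalar // xt.
    by rewrite nsx andbT (torus_nth_power gG te) // (reg_trace_nth_power xG (e := e)) xt.
  rewrite big_pred0 // => x; rewrite memP; apply/negP=> /andP[/andP[xP nsx] /eqP xt].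
  have xT := subsetP PT _ xP; have xG := subsetP TG _ xT.
  move: xP; rewrite (torus_nth_power gG te) // (reg_trace_nth_power xG (e := e)) xt //.
  by rewrite t'P.
by rewrite -addnA -cZ -cR addnC cardsID.
Qed.

End TorusPowers.

(** * Unipotent elements and sums over n-th powers *)

(** Within a class the centralizer orders add up to the group order. A class not contained in the
    set of n-th powers is disjoint from it, since that set is stable under conjugation. *)
Lemma nth_power_classes_sum (gT : finGroupType) n (H : {group gT}) :
  (#|nth_power_classes n H| * #|H| = \sum_(x in nth_powers n H) #|'C_H[x]%g|)%N.
Proof.
have PH := nth_powers_sub n H.
transitivity (\sum_(x in H | x \in nth_powers n H) #|'C_H[x]%g|)%N; last first.
  by apply: eq_bigl => x; case: (boolP (x \in nth_powers _ _)) => [/(subsetP PH) ->|]; rewrite ?andbF.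
rewrite (set_partition_big_cond _ (classes_partition H)) /= -sum1_card.
rewrite big_distrl /= [LHS](eq_bigl (fun C => (C \in classes H) && (C \subset nth_powers n H))) => [|C]; last first.
  by rewrite !inE.
rewrite big_mkcondr /=; apply: eq_bigr => _ /imsetP[x xH ->].
case: (boolP (_ \subset _)) => xP.
  transitivity (\sum_(y in (x ^: H)%g) #|'C_H[x]%g|)%N.
    by rewrite sum_nat_const mul1n -index_cent1 mulnC Lagrange // subsetIl.
  rewrite big_mkcondr /=; apply: eq_bigr => y yx; rewrite (subsetP xP) //.
  case/imsetP: yx => z zH ->.
  by rewrite -{2}(conjGid zH) cent1J -conjIg cardJg.
rewrite big_pred0 // => y; apply/negP=> /andP[/imsetP[z zH ->] yP].
case/negP: xP; apply/subsetP=> _ /imsetP[z' z'H ->].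
have -> : (x ^ z' = (x ^ z) ^ (z^-1 * z'))%g by rewrite -conjgM mulKVg.
by apply: nth_powersJ; rewrite ?groupM ?groupV.
Qed.

Section PowerCounts.
Variable F : finFieldType.
Hypothesis q_odd : odd #|F|.
Variable n : nat.
Local Open Scope ring_scope.
Local Notation q := #|F|.
Local Notation G := (SL2_group F).
Local Notation P := (nth_powers n G).
Local Notation neg1 := (SL2_neg1 F).
Implicit Types (g x y : {'GL_2[F]}) (M : 'M[F]_2) (t s : F) (e : bool).
Let two_neq0 := two_neq0_odd_card q_odd.

(* If [M] has trace 2 and determinant 1 then [M - 1] squares to 0. *)
Lemma unipotent_mulmx M (c d : F) : \tr M = 2%:R -> \det M = 1 ->
  ((1 - c)%:M + c *: M) *m ((1 - d)%:M + d *: M) = (1 - (c + d))%:M + (c + d) *: M.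
Proof.
move=> tM dM; rewrite mulmxDl !mulmxDr -!scalemxAl -!scalemxAr mx2_square tM dM.
rewrite -!scalar_mxM mul_scalar_mx mul_mx_scalar.
by apply: mx2P; rewrite !mxE /=; ring.
Qed.

(** The map sending [c] to [1 - c + c x] turns addition into multiplication, so a k-th power
    multiplies the parameter by [k]. An n-th root of [x], whose parameter is 1, is then found at
    parameter [1 / n]. *)
Lemma unipotent_exp x y (c : F) k : SL2_tr x = 2%:R -> x \in G ->
  GL2mx y = (1 - c)%:M + c *: GL2mx x ->
  GL2mx (y ^+ k)%g = (1 - k%:R * c)%:M + (k%:R * c) *: GL2mx x.
Proof.
move=> tx xG yE; elim: k => [|k IHk].
  by rewrite expg0 GL2mx1 mul0r subr0 scale0r addr0.
by rewrite expgS GL2mxM IHk yE unipotent_mulmx ?SL2_det // mulrS mulrDl mul1r.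
Qed.

Lemma unipotent_expg x k : SL2_tr x = 2%:R -> x \in G ->
  GL2mx (x ^+ k)%g = (1 - k%:R)%:M + k%:R *: GL2mx x.
Proof.
move=> tx xG; rewrite (unipotent_exp (c := 1) k tx xG) ?mulr1 //.
by rewrite subrr scale1r raddf0 add0r.
Qed.

Lemma unipotent_power x : n%:R != 0 :> F -> x \in G -> SL2_tr x = 2%:R -> x \in P.
Proof.
move=> n0 xG tx; pose M := (1 - n%:R^-1)%:M + n%:R^-1 *: GL2mx x.
have dM : \det M = 1.
  by rewrite det_lin_mx2 -/(SL2_tr x) tx SL2_det //; ring.
rewrite (_ : x = (SL2_of_mx M ^+ n)%g) ?mem_nth_powers ?SL2_of_mx_in //.
apply: GL2mx_inj; rewrite (unipotent_exp n tx xG (SL2_of_mxK dM)).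
by rewrite divff // subrr scale1r raddf0 add0r.
Qed.

Lemma GL2mx_neg1M x : GL2mx (neg1 * x)%g = - GL2mx x.
Proof. by rewrite GL2mxM SL2_neg1E mul_scalar_mx scaleN1r. Qed.

Lemma SL2_neg1_comm x : commute neg1 x.
Proof.
by apply: GL2mx_inj; rewrite !GL2mxM SL2_neg1E scalar_mxC.
Qed.

Lemma SL2_neg1M_in x : x \in G -> (neg1 * x)%g \in G.
Proof. exact: groupM (SL2_neg1_in F). Qed.

Lemma SL2_tr_neg1M x : SL2_tr (neg1 * x)%g = - SL2_tr x.
Proof. by rewrite /SL2_tr GL2mx_neg1M raddfN. Qed.

Lemma SL2_neg1K x : (neg1 * (neg1 * x))%g = x.
Proof. by rewrite mulgA -[(neg1 * neg1)%g]/(neg1 ^+ 2)%g SL2_neg1_sqr mul1g. Qed.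

Lemma SL2_neg1X k : (neg1 ^+ k = if odd k then neg1 else 1)%g.
Proof.
rewrite -[k in LHS]odd_double_half -mul2n expgD expgM SL2_neg1_sqr expg1n mulg1.
by case: odd; rewrite ?expg0 ?expg1.
Qed.

Lemma SL2_tr_neg1 : SL2_tr neg1 = - 2%:R.
Proof. by rewrite /SL2_tr SL2_neg1E mxtrace_scalar mulNrn. Qed.

Lemma SL2_tr1 : SL2_tr (1%g : {'GL_2[F]}) = 2%:R.
Proof. by rewrite /SL2_tr GL2mx1 mxtrace_scalar. Qed.

Lemma neg_unipotent_power x : n%:R != 0 :> F -> odd n ->
  x \in G -> SL2_tr x = - 2%:R -> x \in P.
Proof.
move=> n0 n_odd xG tx.
have /imsetP[y yG yE] : (neg1 * x)%g \in P.
  by rewrite unipotent_power ?SL2_neg1M_in ?SL2_tr_neg1M ?tx ?opprK.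
rewrite -(SL2_neg1K x) yE -[X in (X * _)%g]/neg1.
have -> : neg1 = (neg1 ^+ n)%g by rewrite SL2_neg1X n_odd.
by rewrite -(expgMn _ (SL2_neg1_comm y)) mem_nth_powers // SL2_neg1M_in.
Qed.

(** For even [n] an n-th power is a square [z ^+ 2 = tr z * z - 1], of trace [(tr z) ^+ 2 - 2].
    Trace -2 forces [tr z = 0], and the square is then the central element -1. *)
Lemma neg_unipotent_nonpower x : ~~ odd n ->
  x \in G -> ~~ central2 x -> SL2_tr x = - 2%:R -> x \notin P.
Proof.
move=> n_even xG nsx tx; apply/negP=> /imsetP[y yG xE].
have {xE} xE : x = ((y ^+ n./2) ^+ 2)%g.
  by rewrite -expgM muln2 even_halfK.
have zG : (y ^+ n./2)%g \in G by rewrite groupX.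
move: (y ^+ n./2)%g zG xE => z zG /(congr1 (@GL2mx F)).
rewrite expgS expg1 GL2mxM mx2_square (SL2_det zG) => xE.
move: tx nsx; rewrite /central2 /SL2_tr xE raddfB /= mxtraceZ mxtrace_scalar.
move=> /(canRL (subrK _)); rewrite addNr -expr2 => /eqP; rewrite sqrf_eq0 => /eqP ->.
by rewrite scale0r sub0r -raddfN is_scalar2_scalar.
Qed.

(** If [y] has trace 2 or -2 then it is plus or minus a unipotent element, and its n-th power is
    central since [n] vanishes in [F]. Any other [y] has its powers in its torus, where noncentral
    elements have nonzero discriminant. *)
Lemma unipotent_nonpower x : n%:R = 0 :> F ->
  x \in G -> ~~ central2 x -> disc (SL2_tr x) = 0 -> x \notin P.
Proof.
move=> n0 xG nsx dx; apply/negP=> /imsetP[y yG xE].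
have uni z : z \in G -> SL2_tr z = 2%:R -> (z ^+ n)%g = 1%g.
  move=> zG tz; apply: GL2mx_inj.
  by rewrite unipotent_expg // n0 subr0 scale0r addr0 GL2mx1.
case: (eqVneq (disc (SL2_tr y)) 0) => [/eqP|dy].
  rewrite disc_eq0 => /orP[] /eqP ty.
    by case/negP: nsx; rewrite xE uni // /central2 GL2mx1 is_scalar2_scalar.
  have := uni _ (SL2_neg1M_in yG); rewrite SL2_tr_neg1M ty opprK => /(_ erefl).
  rewrite expgMn; last exact: SL2_neg1_comm.
  rewrite -xE SL2_neg1X; case: (odd n) => [x1|].
    case/negP: nsx; rewrite -(SL2_neg1K x) x1 mulg1.
    by rewrite /central2 SL2_neg1E is_scalar2_scalar.
  by rewrite mul1g => x1; case/negP: nsx; rewrite x1 /central2 GL2mx1 is_scalar2_scalar.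
have ye : SL2_tr y \in reg_traces F (is_sqr (disc (SL2_tr y))) by rewrite inE dy eqxx.
have xy : x \in 'C_G[y]%g.
  by rewrite inE xG cent1C; apply/cent1P; rewrite xE; exact: commuteX.
by have := reg_traces_disc (torus_of_mem q_odd yG ye xy nsx); rewrite dx eqxx.
Qed.

(** For even [n], an n-th power of an element of trace 2 or -2 has trace 2, so an n-th root of -1
    has nonzero discriminant and lies in a torus. There the parity of the subgroup of n-th powers
    decides. *)
Lemma SL2_neg1_power :
  (neg1 \in P) = [|| odd n, 2 %| torus_powers F n true | 2 %| torus_powers F n false]%N.
Proof.
case: (boolP (odd n)) => /= n_odd.
  have -> : neg1 = (neg1 ^+ n)%g by rewrite SL2_neg1X n_odd.
  by rewrite mem_nth_powers // SL2_neg1_in.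
apply/idP/idP => [/imsetP[y yG nE]|].
  have uni z : z \in G -> SL2_tr z = 2%:R -> (z ^+ n)%g != neg1.
    move=> zG tz; apply/eqP=> /(congr1 (@SL2_tr F)).
    rewrite SL2_tr_neg1 /SL2_tr unipotent_expg // mxtrace_lin_mx2 -/(SL2_tr z) tz => e.
    by have /eqP := two_neq_opp q_odd; case; rewrite -[RHS]e; ring.
  case: (eqVneq (disc (SL2_tr y)) 0) => [/eqP|dy].
    rewrite disc_eq0 => /orP[] /eqP ty.
      by have := uni y yG ty; rewrite -nE eqxx.
    have := uni _ (SL2_neg1M_in yG); rewrite SL2_tr_neg1M ty opprK => /(_ erefl).
    rewrite expgMn; last exact: SL2_neg1_comm.
    by rewrite SL2_neg1X (negPf n_odd) mul1g -nE eqxx.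
  have ye : SL2_tr y \in reg_traces F (is_sqr (disc (SL2_tr y))) by rewrite inE dy eqxx.
  have [_] := torus_powers_reg q_odd n yG ye.
  rewrite nE mem_nth_powers; last by rewrite inE yG; apply/cent1P.
  by case: is_sqr => <-; rewrite ?orbT.
have pow e : (2 %| torus_powers F n e)%N -> neg1 \in P.
  case: (set_0Vmem (reg_traces F e)) => [K0|[t te]].
    (* With no trace of this type the torus order is 2 and [n] is even, so [torus_powers] is 1,
       which is not divisible by 2. *)
    have := card_reg_tracesE q_odd e; rewrite K0 cards0 /torus_powers => <-.
    by rewrite (_ : gcdn _ n = 2%N) //; apply/gcdn_idPl; rewrite dvdn2.
  have [g gG gt] := SL2_of_tr t; rewrite -gt in te.
  have [_ <-] := torus_powers_reg q_odd n gG te.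
  move=> /imsetP[y /setIP[yG _] ->]; exact: mem_nth_powers.
by case/orP => /pow.
Qed.

(** The trace has [q * q.-1 + q], that is [q ^ 2], elements, of which exactly one is central. *)
Lemma card_unipotent t : disc t = 0 ->
  #|[set x in G | SL2_tr x == t] :\: [set x | central2 x]| = (q ^ 2 - 1)%N.
Proof.
move=> dt; have q0 : (0 < q)%N by apply: ltnW; apply: finNzRing_gt1.
have := cardsID [set x | central2 x] [set x in G | SL2_tr x == t].
rewrite card_SL2_tr // num_sqrtE // dt eqxx muln1.
suff -> : #|[set x in G | SL2_tr x == t] :&: [set x | central2 x]| = 1%N.
  by move: #|_ :\: _| q0 => k; case: q => [|q1] _ /= ; nia.
apply/eqP/cards1P; exists (if t == 2%:R then 1%g else neg1).
apply/setP=> x; rewrite in_set1.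
transitivity [&& x \in G, SL2_tr x == t & central2 x]; first by rewrite !inE andbA.
case: (boolP (x \in G)) => xG /=; last first.
  by apply/esym/eqP=> xE; move: xG; rewrite xE; case: ifP; rewrite ?group1 ?SL2_neg1_in.
rewrite central2E //; move/eqP: dt; rewrite disc_eq0 => /orP[] /eqP ->.
  rewrite eqxx; case: (eqVneq x 1%g) => [->|_]; first by rewrite SL2_tr1 eqxx.
  case: (eqVneq x neg1) => [->|_]; rewrite ?andbF //.
  by rewrite SL2_tr_neg1 eq_sym (negPf (two_neq_opp q_odd)).
rewrite eq_sym eq_sym [- _ == _]eq_sym (negPf (two_neq_opp q_odd)).
case: (eqVneq x neg1) => [->|_]; first by rewrite SL2_tr_neg1 eqxx orbT.
case: (eqVneq x 1%g) => [->|_]; rewrite ?andbF //.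
by rewrite SL2_tr1 (negPf (two_neq_opp q_odd)).
Qed.

Lemma card_reg_powers e :
  (#|P :&: [set x | SL2_tr x \in reg_traces F e]| * torus_order F e
     = #|power_traces F n e| * #|G|)%N.
Proof.
rewrite -sum1_card (partition_big (@SL2_tr F) (mem (reg_traces F e))) /= => [|x]; last first.
  by rewrite !inE => /andP[].
rewrite big_distrl -sum1_card big_distrl big_mkcond [RHS]big_mkcond /=.
apply: eq_bigr => t _; case: ifP => te; last by rewrite inE te.
case: ifP => tP; last first.
  rewrite big_pred0 // => x; apply/negP; move=> /andP[/setIP[xP _] /eqP xt].
  have xG := subsetP (nth_powers_sub n G) x xP.
  by move: xP; rewrite (reg_trace_nth_power q_odd n xG (e := e)) xt ?tP.
rewrite mul1n -(card_reg_SL2_tr q_odd te) sum1_card; congr (_ * _)%N.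
apply: eq_card => x; rewrite unfold_in.
transitivity [&& x \in P, SL2_tr x \in reg_traces F e & SL2_tr x == t].
  by rewrite !inE -andbA.
transitivity ((x \in G) && (SL2_tr x == t)); last by rewrite !inE.
case: (eqVneq (SL2_tr x) t) => [xt|]; rewrite ?andbF // !andbT xt te andbT.
apply/idP/idP => [/(subsetP (nth_powers_sub n G)) //|xG].
by rewrite (reg_trace_nth_power q_odd n xG (e := e)) xt.
Qed.

(** The weight [w] is left general so that 1 yields the number of elements and the centralizer order
    the number of classes. The booleans [up] and [um] record whether the noncentral elements of
    trace 2 and of trace -2 are n-th powers. *)
Lemma sum_nth_powers (up um : bool) (w : {'GL_2[F]} -> nat) (wz wu : nat) (wr : bool -> nat) :
  (forall x, x \in G -> ~~ central2 x -> SL2_tr x = 2%:R -> (x \in P) = up) ->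
  (forall x, x \in G -> ~~ central2 x -> SL2_tr x = - 2%:R -> (x \in P) = um) ->
  (forall x, x \in G -> central2 x -> w x = wz) ->
  (forall x, x \in G -> ~~ central2 x -> disc (SL2_tr x) = 0 -> w x = wu) ->
  (forall e x, x \in G -> SL2_tr x \in reg_traces F e -> w x = wr e) ->
  (\sum_(x in P) w x =
   (1 + (neg1 \in P)) * wz + (up + um) * ((q ^ 2 - 1) * wu)
   + (#|P :&: [set x | SL2_tr x \in reg_traces F true]| * wr true
      + #|P :&: [set x | SL2_tr x \in reg_traces F false]| * wr false))%N.
Proof.
move=> Hup Hum Hz Hu Hr.
have PG := nth_powers_sub n G.
have P1 : 1%g \in P := nth_powers1 n G.
set z := (1 + _)%N.
have cZ : #|P :&: [set x | central2 x]| = z := card_central2 q_odd PG P1.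
rewrite -{z}cZ.
pose U t := [set x in G | SL2_tr x == t] :\: [set x | central2 x].
have cU t b : disc t = 0 ->
    (forall x, x \in G -> ~~ central2 x -> SL2_tr x = t -> (x \in P) = b) ->
    #|P :&: U t| = (b * (q ^ 2 - 1))%N.
  move=> dt Ht; rewrite -(card_unipotent dt) -/(U t).
  case: b Ht => Ht; rewrite ?mul1n ?mul0n.
    congr #|pred_of_set _|; apply/setIidPr/subsetP=> x.
    by rewrite !inE => /and3P[nsx dx /eqP tx]; rewrite Ht // inE.
  apply: eq_card0 => x; rewrite !in_setI; apply/negP=> /andP[xP].
  rewrite !inE => /and3P[nsx xG /eqP tx].
  by rewrite Ht // inE in xP.
have d2 : disc (2%:R : F) = 0 by apply/eqP; rewrite disc_eq0 eqxx.
have dm2 : disc (- 2%:R : F) = 0 by apply/eqP; rewrite disc_eq0 eqxx orbT.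
rewrite mulnDl !mulnA -(cU _ _ d2 Hup) -(cU _ _ dm2 Hum).
have sumE (A : {set {'GL_2[F]}}) c : (#|P :&: A| * c = \sum_(x in P) (x \in A) * c)%N.
  rewrite -sum1_card big_distrl /= (eq_bigl (fun x => (x \in P) && (x \in A))) => [|x].
    by rewrite big_mkcondr; apply: eq_bigr => x _; case: (x \in A).
  by rewrite inE.
rewrite !sumE -!big_split /=; apply: eq_bigr => x xP.
have xG := subsetP PG _ xP.
have inU t : (x \in U t) = ~~ central2 x && (SL2_tr x == t).
  transitivity [&& ~~ central2 x, x \in G & SL2_tr x == t]; last by rewrite xG.
  by rewrite !inE.
rewrite !inU ![x \in [set _ | _]]inE.
case: (boolP (central2 x)) => [cx|nsx] /=.
  have dx := central2_disc xG cx.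
  by rewrite Hz // /reg_traces !inE dx eqxx /= mul1n !addn0.
case: (eqVneq (disc (SL2_tr x)) 0) => [dx|dx].
  rewrite (Hu _ xG nsx dx) /reg_traces !inE dx eqxx /= !addn0.
  move/eqP: dx; rewrite disc_eq0; case: (eqVneq (SL2_tr x) 2%:R) => [->|_ /= ->].
    by rewrite (negPf (two_neq_opp q_odd)) ?mul1n ?mul0n ?add0n ?addn0.
  by rewrite ?mul1n ?mul0n ?add0n ?addn0.
have xe : SL2_tr x \in reg_traces F (is_sqr (disc (SL2_tr x))) by rewrite inE dx eqxx.
rewrite (Hr _ _ xG xe) !inE dx /=.
move: dx; rewrite disc_eq0 negb_or => /andP[/negPf -> /negPf ->] /=.
by case: (is_sqr _); rewrite /= ?mul1n ?mul0n ?add0n ?addn0.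
Qed.

End PowerCounts.

Lemma sqrn_sub1 m : (m ^ 2 - 1 = m.-1 * m.+1)%N.
Proof. by rewrite -[in LHS](exp1n 2) subn_sqr subn1 addn1. Qed.

(** * Both counts in terms of the numbers of power traces *)

Section PowerFormulas.
Variable F : finFieldType.
Hypothesis q_odd : odd #|F|.
Variables (n : nat) (up um : bool).
Local Open Scope ring_scope.
Local Notation q := #|F|.
Local Notation G := (SL2_group F).
Local Notation P := (nth_powers n G).
Local Notation a := #|power_traces F n true|.
Local Notation b := #|power_traces F n false|.
Local Notation z := (SL2_neg1 F \in P).
Hypothesis Hup : forall x, x \in G -> ~~ central2 x -> SL2_tr x = 2%:R -> (x \in P) = up.
Hypothesis Hum : forall x, x \in G -> ~~ central2 x -> SL2_tr x = - 2%:R -> (x \in P) = um.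

Lemma num_pow_traces :
  num_pow n F = (1 + z + (up + um) * (q.-1 * q.+1) + a * (q * q.+1) + b * (q * q.-1))%N.
Proof.
have q1 : (1 < q)%N by exact: finNzRing_gt1.
have cr e := card_reg_powers q_odd n e.
have ca : #|P :&: [set x | SL2_tr x \in reg_traces F true]| = (a * (q * q.+1))%N.
  have := cr true; rewrite card_SL2 // /torus_order => h.
  apply/eqP; rewrite -(eqn_pmul2r (m := q.-1)); last by case: q q1 => [|[]].
  by rewrite h; apply/eqP; ring.
have cb : #|P :&: [set x | SL2_tr x \in reg_traces F false]| = (b * (q * q.-1))%N.
  have := cr false; rewrite card_SL2 // /torus_order => h.
  apply/eqP; rewrite -(eqn_pmul2r (m := q.+1)) //.
  by rewrite h; apply/eqP; ring.
rewrite /num_pow -sum1_card.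
rewrite (sum_nth_powers q_odd (wz := 1) (wu := 1) (wr := fun=> 1%N) Hup Hum) //.
rewrite ca cb !muln1 addnA; congr (_ + _ * _ + _ + _)%N.
by rewrite sqrn_sub1.
Qed.

(** After division by [#|G|], a central element and a regular trace each count 1, while each sign of
    the unipotent part counts [(q ^ 2 - 1) * (2 * q) / #|G| = 2]. *)
Lemma num_pow_classes_traces :
  num_pow_classes n F = (1 + z + 2 * (up + um) + a + b)%N.
Proof.
apply/eqP; rewrite -(eqn_pmul2r (cardG_gt0 G)) -/(num_pow_classes n F).
have := nth_power_classes_sum n G; rewrite -/(num_pow_classes n F) => ->.
rewrite (sum_nth_powers q_odd (wz := #|G|) (wu := (2 * q)%N) (wr := torus_order F) Hup Hum).
- rewrite !card_reg_powers // card_SL2 // sqrn_sub1.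
  by apply/eqP; ring.
- move=> x xG; rewrite central2E // => cx; congr #|pred_of_set _|.
  apply/setIidPl/subsetP=> y yG; apply/cent1P.
  by case/orP: cx => /eqP ->; [exact: commute1|exact/commute_sym/SL2_neg1_comm].
- exact: card_cent_unipotent.
- by move=> e x xG xe; apply: card_torus.
Qed.

End PowerFormulas.

Section PowerFormulasCases.
Variable F : finFieldType.
Hypothesis q_odd : odd #|F|.
Variable n : nat.
Local Open Scope ring_scope.
Local Notation q := #|F|.
Local Notation a := #|power_traces F n true|.
Local Notation b := #|power_traces F n false|.
Local Notation z := [|| odd n, 2 %| torus_powers F n true | 2 %| torus_powers F n false]%N.

Lemma num_pow_coprime : n%:R != 0 :> F ->
  num_pow n F = (1 + z + (1 + odd n) * (q.-1 * q.+1) + a * (q * q.+1) + b * (q * q.-1))%N /\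
  num_pow_classes n F = (1 + z + 2 * (1 + odd n) + a + b)%N.
Proof.
move=> n0; rewrite -(SL2_neg1_power q_odd n).
have Hup x : x \in SL2_group F -> ~~ central2 x -> SL2_tr x = 2%:R ->
    (x \in nth_powers n (SL2_group F)) = true.
  by move=> xG _; apply: unipotent_power.
have Hum x : x \in SL2_group F -> ~~ central2 x -> SL2_tr x = - 2%:R ->
    (x \in nth_powers n (SL2_group F)) = odd n.
  move=> xG nsx tx; case: (boolP (odd n)) => n_odd.
    exact: neg_unipotent_power.
  by apply/negbTE/neg_unipotent_nonpower.
by rewrite (num_pow_traces q_odd Hup Hum) (num_pow_classes_traces q_odd Hup Hum).
Qed.

Lemma num_pow_pchar : n%:R = 0 :> F -> odd n ->
  num_pow n F = (2 + a * (q * q.+1) + b * (q * q.-1))%N /\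
  num_pow_classes n F = (2 + a + b)%N.
Proof.
move=> n0 n_odd.
have H t x : disc t = 0 -> x \in SL2_group F -> ~~ central2 x -> SL2_tr x = t ->
    (x \in nth_powers n (SL2_group F)) = false.
  by move=> dt xG nsx tx; apply/negbTE/unipotent_nonpower; rewrite ?tx.
have d2 : disc (2%:R : F) = 0 by apply/eqP; rewrite disc_eq0 eqxx.
have dm2 : disc (- 2%:R : F) = 0 by apply/eqP; rewrite disc_eq0 eqxx orbT.
rewrite (num_pow_traces q_odd (fun x => H _ x d2) (fun x => H _ x dm2)).
rewrite (num_pow_classes_traces q_odd (fun x => H _ x d2) (fun x => H _ x dm2)).
by rewrite (SL2_neg1_power q_odd n) n_odd.
Qed.

End PowerFormulasCases.

(** * Explicit counts *)

Section Formulas.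
Variables (F : finFieldType) (R : realFieldType).
Hypothesis q_odd : odd #|F|.
Local Open Scope ring_scope.
Local Notation q := #|F|.
Local Notation qR := (q%:R : R).

(** The coprime cofactors [m] and [m'] certify that [d] is the greatest common divisor, so that no
    gcd with a symbolic [q] has to be computed. *)
Lemma torus_powersE n e d m m' :
  (0 < d)%N -> torus_order F e = (d * m)%N -> n = (d * m')%N -> coprime m m' ->
  torus_powers F n e = m.
Proof.
move=> d0 oE -> /eqP co.
by rewrite /torus_powers oE -muln_gcdr co muln1 mulKn.
Qed.

Lemma card_power_tracesE n e d m m' :
  (0 < d)%N -> torus_order F e = (d * m)%N -> n = (d * m')%N -> coprime m m' ->
  (#|power_traces F n e|.*2 + 1 + ~~ odd m = m)%N.
Proof.
move=> d0 oE nE co; have := card_power_traces q_odd n e.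
by rewrite (torus_powersE d0 oE nE co) dvdn2.
Qed.

Lemma num_pow_coprimeR n d1 m1 m1' d2 m2 m2' :
  (0 < d1)%N -> (0 < d2)%N -> coprime n q ->
  (q.-1 = d1 * m1)%N -> n = (d1 * m1')%N -> coprime m1 m1' ->
  (q.+1 = d2 * m2)%N -> n = (d2 * m2')%N -> coprime m2 m2' ->
  let z := ([|| odd n, ~~ odd m1 | ~~ odd m2] : nat)%:R : R in
  let u := 1 + (odd n : nat)%:R : R in
  let a := (m1%:R - 1 - (~~ odd m1 : nat)%:R) / 2%:R : R in
  let b := (m2%:R - 1 - (~~ odd m2 : nat)%:R) / 2%:R : R in
  (num_pow n F)%:R = 1 + z + u * (qR ^+ 2 - 1) + a * (qR * (qR + 1)) + b * (qR * (qR - 1)) /\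
  (num_pow_classes n F)%:R = 1 + z + 2%:R * u + a + b.
Proof.
move=> d1_gt0 d2_gt0 co e1 n1 co1 e2 n2 co2 z u a b.
have a_eq := card_power_tracesE (e := true) d1_gt0 e1 n1 co1.
have b_eq := card_power_tracesE (e := false) d2_gt0 e2 n2 co2.
have aE : #|power_traces F n true|%:R = a.
  by rewrite /a -{1}a_eq !natrD -mul2n natrM; field.
have bE : #|power_traces F n false|%:R = b.
  by rewrite /b -{1}b_eq !natrD -mul2n natrM; field.
have [-> ->] := num_pow_coprime q_odd (coprime_card_finField co).
rewrite (torus_powersE (e := true) d1_gt0 e1 n1 co1).
rewrite (torus_powersE (e := false) d2_gt0 e2 n2 co2) !dvdn2.
have q1 : q.-1%:R = qR - 1 :> R.
  by rewrite -subn1 natrB // ltnW // finNzRing_gt1.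
have q2 : q.+1%:R = qR + 1 :> R by rewrite -addn1 natrD.
by rewrite !(natrD, natrM) aE bE q1 q2 -/z; split; rewrite /u; ring.
Qed.

End Formulas.

(** * The congruence cases for exponents 2 and 4 and for odd primes *)

Section FormulaCases.
Variables (F : finFieldType) (R : realFieldType).
Hypothesis q_odd : odd #|F|.
Local Open Scope ring_scope.
Local Notation q := #|F|.
Local Notation qR := (q%:R : R).
Local Notation c n := ((num_pow_classes n F)%:R : R).
Local Notation s n := ((num_pow n F)%:R : R).

Lemma coprime2q : coprime 2 q.
Proof. by rewrite coprime2n. Qed.

Lemma coprime4q : coprime 4 q.
Proof. by rewrite (coprimeXl 2 coprime2q). Qed.

Lemma square_count_1mod4 : q = 1 %[mod 4] ->
  c 2 = (qR + 5) / 2 /\ s 2 = qR ^+ 2 * (qR - 1) / 2 - qR + 1.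
Proof.
move=> q4; have [k qE] : exists k, q = (4 * k + 1)%N by exists (q %/ 4)%N; lia.
(* After the exponent come two triples of a gcd and its cofactors: [q - 1 = 2 * (2 k)] with
   [2 = 2 * 1], then [q + 1 = 2 * (2 k + 1)] with [2 = 2 * 1]. The other cases follow the same
   pattern. *)
have [-> ->] := @num_pow_coprimeR F R q_odd 2 2 (2 * k) 1 2 (2 * k + 1) 1
  isT isT coprime2q ltac:(lia) erefl (coprimen1 _) ltac:(lia) erefl (coprimen1 _).
have -> : qR = 4%:R * k%:R + 1 by rewrite qE natrD natrM.
by rewrite !(oddD, oddM) /= !(natrD, natrM); split; field.
Qed.

Lemma square_count_3mod4 : q = 3 %[mod 4] ->
  c 2 = (qR + 5) / 2 /\ s 2 = qR ^+ 2 * (qR - 1) / 2 + 1.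
Proof.
move=> q4; have [k qE] : exists k, q = (4 * k + 3)%N by exists (q %/ 4)%N; lia.
have [-> ->] := @num_pow_coprimeR F R q_odd 2 2 (2 * k + 1) 1 2 (2 * k + 2) 1
  isT isT coprime2q ltac:(lia) erefl (coprimen1 _) ltac:(lia) erefl (coprimen1 _).
have -> : qR = 4%:R * k%:R + 3%:R by rewrite qE natrD natrM.
by rewrite !(oddD, oddM) /= !(natrD, natrM); split; field.
Qed.

Lemma fourth_count_1mod8 : q = 1 %[mod 8] ->
  c 4 = (3 * qR + 21) / 8 /\
  s 4 = 3 / 8 * qR ^+ 3 - 1 / 2 * qR ^+ 2 - 7 / 8 * qR + 1.
Proof.
move=> q8; have [k qE] : exists k, q = (8 * k + 1)%N by exists (q %/ 8)%N; lia.
have [-> ->] := @num_pow_coprimeR F R q_odd 4 4 (2 * k) 1 2 (4 * k + 1) 2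
  isT isT coprime4q ltac:(lia) erefl (coprimen1 _) ltac:(lia) erefl
  ltac:(by rewrite coprimen2 oddD oddM).
have -> : qR = 8%:R * k%:R + 1 by rewrite qE natrD natrM.
by rewrite !(oddD, oddM) /= !(natrD, natrM); split; field.
Qed.

(** Both groups of fourth powers have odd order here, as they do for 5 modulo 8, so -1 is not a
    fourth power. In the classes 1 and 7 it is one. *)
Lemma fourth_count_3mod8 : q = 3 %[mod 8] ->
  c 4 = (3 * qR + 15) / 8 /\ s 4 = 3 / 8 * (qR ^+ 3 - qR).
Proof.
move=> q8; have [k qE] : exists k, q = (8 * k + 3)%N by exists (q %/ 8)%N; lia.
have [-> ->] := @num_pow_coprimeR F R q_odd 4 2 (4 * k + 1) 2 4 (2 * k + 1) 1
  isT isT coprime4q ltac:(lia) erefl ltac:(by rewrite coprimen2 oddD oddM)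
  ltac:(lia) erefl (coprimen1 _).
have -> : qR = 8%:R * k%:R + 3%:R by rewrite qE natrD natrM.
by rewrite !(oddD, oddM) /= !(natrD, natrM); split; field.
Qed.

Lemma fourth_count_5mod8 : q = 5 %[mod 8] ->
  c 4 = (3 * qR + 17) / 8 /\ s 4 = 3 / 8 * (qR ^+ 3 - qR).
Proof.
move=> q8; have [k qE] : exists k, q = (8 * k + 5)%N by exists (q %/ 8)%N; lia.
have [-> ->] := @num_pow_coprimeR F R q_odd 4 4 (2 * k + 1) 1 2 (4 * k + 3) 2
  isT isT coprime4q ltac:(lia) erefl (coprimen1 _) ltac:(lia) erefl
  ltac:(by rewrite coprimen2 oddD oddM).
have -> : qR = 8%:R * k%:R + 5%:R by rewrite qE natrD natrM.
by rewrite !(oddD, oddM) /= !(natrD, natrM); split; field.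
Qed.

(** The constant 19 can be tested at [q = 7], where there are five classes: 1, -1 (the fourth power
    of an element of order 8), two unipotent classes, and the elements of order 3. *)
Lemma fourth_count_7mod8 : q = 7 %[mod 8] ->
  c 4 = (3 * qR + 19) / 8 /\
  s 4 = 3 / 8 * qR ^+ 3 - 1 / 2 * qR ^+ 2 + 1 / 8 * qR + 1.
Proof.
move=> q8; have [k qE] : exists k, q = (8 * k + 7)%N by exists (q %/ 8)%N; lia.
have [-> ->] := @num_pow_coprimeR F R q_odd 4 2 (4 * k + 3) 2 4 (2 * k + 2) 1
  isT isT coprime4q ltac:(lia) erefl ltac:(by rewrite coprimen2 oddD oddM)
  ltac:(lia) erefl (coprimen1 _).
have -> : qR = 8%:R * k%:R + 7%:R by rewrite qE natrD natrM.
by rewrite !(oddD, oddM) /= !(natrD, natrM); split; field.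
Qed.

Variable n : nat.
Hypotheses (n_pr : prime n) (n_odd : odd n).
Local Notation m := (n%:R : R).

Let dvd2F k : (n %| k)%N -> (n %| k.+2)%N -> False.
Proof.
move=> nk; rewrite -addn2 (dvdn_addr _ nk) => n2; have := dvdn_leq (isT : 0 < 2)%N n2; move: n_odd n_pr.
by case: n => [|[|[|]]].
Qed.

Let dvd1F k : (n %| k)%N -> (n %| k.+1)%N -> False.
Proof.
by move=> nk; rewrite -addn1 (dvdn_addr _ nk) dvdn1; case: eqP n_pr => // ->.
Qed.

Let coprimeN k : ~ (n %| k)%N -> coprime k n.
Proof. by move=> nk; rewrite coprime_sym prime_coprime //; apply/negP. Qed.

Let q_gt1 : (1 < q)%N. Proof. exact: finNzRing_gt1. Qed.

Let q_pred : q.-1.+1 = q. Proof. by rewrite prednK // ltnW. Qed.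

Let q1_even : ~~ odd q.-1. Proof. by have := q_odd; rewrite -{1}q_pred. Qed.

Let m_neq0 : m != 0. Proof. by rewrite pnatr_eq0 -lt0n prime_gt0. Qed.

(** Since [n] divides [q], it is prime to both torus orders: every semisimple element is an n-th
    power, and only the noncentral elements of trace 2 and -2 are lost. The [q - 2] regular traces
    and the two central elements make [q] classes. *)
Lemma prime_count_pchar : (n %| q)%N ->
  c n = qR /\ s n = (qR - 2) * (qR ^+ 2 - 1).
Proof.
move=> nq; have n0 : n%:R = 0 :> F.
  by apply/eqP; rewrite -prime_dvd_card_finField.
have [-> ->] := num_pow_pchar q_odd n0 n_odd.
have co1 : coprime q.-1 n by apply: coprimeN => /dvd1F; rewrite q_pred => /(_ nq).
have co2 : coprime q.+1 n by apply: coprimeN; exact: dvd1F.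
have [k qE] : exists k, q = (2 * k + 1)%N by exists (q %/ 2)%N; lia.
have a_eq := @card_power_tracesE F q_odd n true 1 q.-1 n
  isT (esym (mul1n _)) (esym (mul1n _)) co1.
have b_eq := @card_power_tracesE F q_odd n false 1 q.+1 n
  isT (esym (mul1n _)) (esym (mul1n _)) co2.
have aE : (#|power_traces F n true| + 1 = k)%N by lia.
have bE : #|power_traces F n false| = k by lia.
rewrite bE qE addn1 -addn1 /= !(natrD, natrM) -aE natrD.
by split; ring.
Qed.

(** An odd prime dividing [q - 1] cannot divide [q + 1], so only the split tori lose elements. The
    cofactor [j] of [n] in [q - 1] is even, as [n] is odd. *)
Lemma prime_count_split : (n %| q - 1)%N ->
  c n = (m + 1) * (qR - 1) / (2 * m) + 5 /\
  s n = (m + 1) * (qR ^+ 3 - qR) / (2 * m).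
Proof.
rewrite subn1 => nq1; have /dvdnP[j jE] := nq1.
have j_even : ~~ odd j by have := q1_even; rewrite jE oddM n_odd andbT.
have co_q : coprime n q.
  by rewrite coprime_sym; apply: coprimeN; rewrite -q_pred; exact: dvd1F.
have co2 : coprime q.+1 n.
  by apply: coprimeN; rewrite -q_pred; exact: dvd2F.
have e1 : q.-1 = (n * j)%N by rewrite jE mulnC.
have [-> ->] := @num_pow_coprimeR F R q_odd n n j 1 1 q.+1 n (prime_gt0 n_pr) isT
  co_q e1 (esym (muln1 _)) (coprimen1 _) (esym (mul1n _)) (esym (mul1n _)) co2.
have qE : qR = m * j%:R + 1 by rewrite -[in LHS]q_pred e1 -addn1 natrD natrM.
have q2 : q.+1%:R = qR + 1 :> R by rewrite -addn1 natrD.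
rewrite n_odd j_even /= q_odd /= q2 qE.
by split; field.
Qed.

Lemma prime_count_nonsplit : (n %| q + 1)%N ->
  c n = ((m + 1) * (qR - 3) + 4) / (2 * m) + 5 /\
  s n = (m + 1) * (qR ^+ 3 - qR) / (2 * m).
Proof.
rewrite addn1 => nq1; have /dvdnP[j jE] := nq1.
have j_even : ~~ odd j.
  by have := congr1 odd jE; rewrite oddS q_odd oddM n_odd andbT => <-.
have co_q : coprime n q.
  by rewrite coprime_sym; apply: coprimeN => /dvd1F; apply.
have co1 : coprime q.-1 n.
  by apply: coprimeN => /dvd2F; rewrite q_pred => /(_ nq1).
have e2 : q.+1 = (n * j)%N by rewrite jE mulnC.
have [-> ->] := @num_pow_coprimeR F R q_odd n 1 q.-1 n n j 1 isT (prime_gt0 n_pr)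
  co_q (esym (mul1n _)) (esym (mul1n _)) co1 e2 (esym (muln1 _)) (coprimen1 _).
have qE : qR = m * j%:R - 1 by rewrite -natrM -e2 -addn1 natrD addrK.
have q1 : q.-1%:R = qR - 1 :> R by rewrite -subn1 natrB // ltnW.
rewrite n_odd j_even q1_even /= q1 qE.
by split; field.
Qed.

End FormulaCases.

(** * Limits *)

From mathcomp Require Import all_classical all_reals all_analysis.
Import numFieldNormedType.Exports.

Unset Implicit Arguments.
Local Open Scope classical_set_scope.
Local Open Scope ring_scope.

Lemma cvg_infty_rate (R : realType) (E : set_system nat) (FE : Filter E)
    (f : nat -> R) (l K : R) :
  E --> \oo -> (\forall q \near E, `|f q - l| <= K / q%:R) -> f @ E --> l.
Proof.
move=> Eoo fl; apply/cvgrPdist_le => eps eps0.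
have big : \forall q \near E, (K / eps <= q%:R) && (1 <= q%:R :> R).
  apply: Eoo; near=> q; apply/andP; split; near: q; exact: nbhs_infty_ger.
near=> q; rewrite distrC.
have /andP[qK q1] : (K / eps <= q%:R) && (1 <= q%:R :> R) by near: q.
have q0 : 0 < q%:R :> R by lra.
have : `|f q - l| <= K / q%:R by near: q.
move=> /le_trans; apply.
by rewrite ler_pdivrMr // mulrC -ler_pdivrMr.
Unshelve. all: by end_near. Qed.

Lemma class_ratio_rate (R : realFieldType) (c l K q : R) :
  0 < q -> `|c - l * (q + 4)| <= K -> `|c / (q + 4) - l| <= K / q.
Proof.
move=> q0 cK; have q4 : 0 < q + 4 by lra.
have -> : c / (q + 4) - l = (c - l * (q + 4)) / (q + 4) by field; lra.
rewrite normrM normfV (gtr0_norm q4) ler_pM ?invr_ge0 // ?lef_pV2 ?posrE //; lra.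
Qed.

Lemma element_ratio_rate (R : realFieldType) (s l K q : R) :
  2 <= q -> `|s - l * (q ^+ 3 - q)| <= K * q ^+ 2 ->
  `|s / (q ^+ 3 - q) - l| <= (2 * K) / q.
Proof.
move=> q2 sK.
(* This comparison of [q ^+ 3] with the group order, valid from [q = 2] on, is the origin of the
   factor 2 in the bound. *)
have q3 : q ^+ 3 <= 2 * (q ^+ 3 - q) by rewrite !exprS expr0; nra.
have q30 : 0 < q ^+ 3 by rewrite exprn_gt0; lra.
have d0 : 0 < q ^+ 3 - q by lra.
have -> : s / (q ^+ 3 - q) - l = (s - l * (q ^+ 3 - q)) / (q ^+ 3 - q) by field; lra.
rewrite normrM normfV (gtr0_norm d0) ler_pdivrMr //.
apply: (le_trans sK).
have K0 : 0 <= K.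
  by rewrite -(pmulr_lge0 K (_ : 0 < q ^+ 2)) ?(le_trans _ sK) // exprn_gt0; lra.
have -> : K * q ^+ 2 = K / q * q ^+ 3 by field; lra.
have -> : 2 * K / q * (q ^+ 3 - q) = K / q * (2 * (q ^+ 3 - q)) by field; lra.
by rewrite ler_wpM2l // divr_ge0 //; lra.
Qed.

Lemma odd_prime_power_ge3 q : odd_prime_power q -> (3 <= q)%N.
Proof.
case=> q_odd [p [k [p_pr k0 qE]]].
have : q != 1%N by rewrite qE -(exp1n k) eqn_exp2r // neq_ltn prime_gt1 ?orbT.
by case: q q_odd {qE} => [|[|[|]]].
Qed.

(** It suffices to bound the errors of the two numerators by [K] and [K * q ^+ 2] uniformly, which
    leaves ratio errors of order [1 / q]. The set [D] serves to exclude the [q] divisible by an odd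
    prime [n]. *)
Lemma power_ratios_cvg (R : realType) (n : nat) (l K : R) (D : set nat) :
  (forall F : finFieldType, odd #|F| -> (2 < #|F|)%N -> D #|F| ->
     (n %| #|F| ^ 3 - #|F|)%N ->
     `|(num_pow_classes n F)%:R - l * (#|F|%:R + 4)| <= K /\
     `|(num_pow n F)%:R - l * (#|F|%:R ^+ 3 - #|F|%:R)| <= K * #|F|%:R ^+ 2) ->
  ((num_pow_classes n (GF q))%:R / (q%:R + 4) : R)
     @[q --> within D (q_infty n)] --> l /\
  ((num_pow n (GF q))%:R / (q%:R ^+ 3 - q%:R) : R)
     @[q --> within D (q_infty n)] --> l.
Proof.
move=> bnd.
have Doo : within D (q_infty n) --> \oo.
  by apply: cvg_trans; [apply: cvg_within | exact: cvg_within].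
have near_D : \forall q \near within D (q_infty n),
    odd_prime_power q /\ (n %| q ^ 3 - q)%N /\ D q.
  by rewrite /q_infty !near_withinE; near=> q => [[? ?]].
split; [apply: (@cvg_infty_rate _ _ _ _ _ K) | apply: (@cvg_infty_rate _ _ _ _ _ (2 * K))] => //.
- near=> q.
  have [q_opp [nq Dq]] : odd_prime_power q /\ (n %| q ^ 3 - q)%N /\ D q by near: q.
  have q3 := odd_prime_power_ge3 _ q_opp; have cF := card_GF q_opp.
  have := bnd (GF q); rewrite cF => /(_ q_opp.1 q3 Dq nq)[+ _].
  by apply: class_ratio_rate; rewrite ltr0n; lia.
- near=> q.
  have [q_opp [nq Dq]] : odd_prime_power q /\ (n %| q ^ 3 - q)%N /\ D q by near: q.
  have q3 := odd_prime_power_ge3 _ q_opp; have cF := card_GF q_opp.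
  have := bnd (GF q); rewrite cF => /(_ q_opp.1 q3 Dq nq)[_].
  by apply: element_ratio_rate; rewrite ler_nat; lia.
Unshelve. all: by end_near. Qed.

Lemma within_setT (T : Type) (E : set_system T) : within setT E = E.
Proof.
apply/funext => A; rewrite /within; congr (E _).
by apply/funext => x; apply/propext; split=> [|Ax _]; [apply|].
Qed.

Lemma square_ratio_bound (R : realType) (F : finFieldType) : odd #|F| -> (2 < #|F|)%N ->
  `|(num_pow_classes 2 F)%:R - 1 / 2 * (#|F|%:R + 4)| <= 2 :> R /\
  `|(num_pow 2 F)%:R - 1 / 2 * (#|F|%:R ^+ 3 - #|F|%:R)| <= 2 * #|F|%:R ^+ 2 :> R.
Proof.
move=> q_odd q3.
have [|] : #|F| = 1 %[mod 4] \/ #|F| = 3 %[mod 4] by lia.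
  move/(square_count_1mod4 R q_odd) => [-> ->].
  have : 2 < #|F|%:R :> R by rewrite ltr_nat.
  move: (#|F|%:R : R) => q q2; rewrite !ler_norml; split; first by lra.
  by rewrite !exprS expr0; apply/andP; split; nra.
move/(square_count_3mod4 R q_odd) => [-> ->].
have : 2 < #|F|%:R :> R by rewrite ltr_nat.
move: (#|F|%:R : R) => q q2; rewrite !ler_norml; split; first by lra.
by rewrite !exprS expr0; apply/andP; split; nra.
Qed.

Lemma fourth_ratio_bound (R : realType) (F : finFieldType) : odd #|F| -> (2 < #|F|)%N ->
  `|(num_pow_classes 4 F)%:R - 3 / 8 * (#|F|%:R + 4)| <= 2 :> R /\
  `|(num_pow 4 F)%:R - 3 / 8 * (#|F|%:R ^+ 3 - #|F|%:R)| <= 2 * #|F|%:R ^+ 2 :> R.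
Proof.
move=> q_odd q3; have : 2 < #|F|%:R :> R by rewrite ltr_nat.
have [|[|[|]]] : #|F| = 1 %[mod 8] \/ #|F| = 3 %[mod 8] \/
                 #|F| = 5 %[mod 8] \/ #|F| = 7 %[mod 8] by lia.
- move/(fourth_count_1mod8 R q_odd) => [-> ->].
  move: (#|F|%:R : R) => q q2; rewrite !ler_norml; split; first by lra.
  by rewrite !exprS expr0; apply/andP; split; nra.
- move/(fourth_count_3mod8 R q_odd) => [-> ->].
  move: (#|F|%:R : R) => q q2; rewrite !ler_norml; split; first by lra.
  by rewrite !exprS expr0; apply/andP; split; nra.
- move/(fourth_count_5mod8 R q_odd) => [-> ->].
  move: (#|F|%:R : R) => q q2; rewrite !ler_norml; split; first by lra.
  by rewrite !exprS expr0; apply/andP; split; nra.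
- move/(fourth_count_7mod8 R q_odd) => [-> ->].
  move: (#|F|%:R : R) => q q2; rewrite !ler_norml; split; first by lra.
  by rewrite !exprS expr0; apply/andP; split; nra.
Qed.

(** The number of elements is exactly [l * (q ^+ 3 - q)] in both cases. The class count deviates by
    [5 / 2 * (1 - 1 / n)] or [3 / 2 * (1 - 1 / n)], hence by less than 5. *)
Lemma prime_ratio_bound (R : realType) (n : nat) (F : finFieldType) :
  prime n -> odd n -> odd #|F| -> (2 < #|F|)%N -> ~~ (n %| #|F|)%N ->
  (n %| #|F| ^ 3 - #|F|)%N ->
  let l : R := (n%:R + 1) / (2 * n%:R) in
  `|(num_pow_classes n F)%:R - l * (#|F|%:R + 4)| <= 5 :> R /\
  `|(num_pow n F)%:R - l * (#|F|%:R ^+ 3 - #|F|%:R)| <= 5 * #|F|%:R ^+ 2 :> R.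
Proof.
move=> n_pr n_odd q_odd q3 ndvd ndvd3 l.
have n1 : 1 < n%:R :> R by rewrite ltr1n prime_gt1.
have lE : l = 1 / 2 + (1 / 2) / n%:R by rewrite /l; field; lra.
have invn : 0 < (n%:R : R)^-1 < 1 by rewrite invr_gt0 invf_lt1; lra.
have q2_ge0 : 0 <= (#|F|%:R : R) ^+ 2 by exact: sqr_ge0.
have : (n %| #|F| - 1)%N || (n %| #|F| + 1)%N.
  rewrite -Euclid_dvdM // -subn_sqr exp1n.
  have : (n %| #|F| * (#|F| ^ 2 - 1))%N by rewrite mulnBr muln1 -expnS.
  by rewrite Euclid_dvdM // (negPf ndvd).
case/orP => dvd; [have [-> ->] := prime_count_split R q_odd n_pr n_odd dvd
                 | have [-> ->] := prime_count_nonsplit R q_odd n_pr n_odd dvd].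
- split; last first.
    rewrite (_ : _ - _ = 0) ?normr0 ?mulr_ge0 //.
    by rewrite /l; field; lra.
  rewrite (_ : _ - _ = 5 / 2 - 5 / 2 / n%:R); last by rewrite /l; field; lra.
  by rewrite ler_norml; apply/andP; split; nra.
- split; last first.
    rewrite (_ : _ - _ = 0) ?normr0 ?mulr_ge0 //.
    by rewrite /l; field; lra.
  rewrite (_ : _ - _ = 3 / 2 - 3 / 2 / n%:R); last by rewrite /l; field; lra.
  by rewrite ler_norml; apply/andP; split; nra.
Qed.

(** For odd prime [n] the limits are taken over [q] not divisible by [n]: along the powers of [n]
    both ratios tend to 1, so the unrestricted limits do not exist, and [q_infty_coprime] shows that
    the restricted ones are not vacuous. For [q] congruent to 7 modulo 8 the class count of fourth
    powers is [(3 q + 19) / 8], in place of the [(3 q + 11) / 8] of the opening statement, which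
    gives 4 instead of the correct 5 at [q = 7]. *)
Theorem theorem5p1 (R : realType) :
  [/\ (forall F : finFieldType, odd #|F| -> (2 %| #|F| ^ 3 - #|F|)%N ->
         let q : R := #|F|%:R in
         let c : R := (num_pow_classes 2 F)%:R in
         let s : R := (num_pow 2 F)%:R in
         [/\ #|F| = 1 %[mod 4] ->
               c = (q + 5) / 2 /\ s = q ^+ 2 * (q - 1) / 2 - q + 1
           & #|F| = 3 %[mod 4] ->
               c = (q + 5) / 2 /\ s = q ^+ 2 * (q - 1) / 2 + 1])
      /\ ((num_pow_classes 2 (GF q))%:R / (q%:R + 4) : R)
           @[q --> q_infty 2] --> (1 / 2 : R)
      /\ ((num_pow 2 (GF q))%:R / (q%:R ^+ 3 - q%:R) : R)
           @[q --> q_infty 2] --> (1 / 2 : R),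
      (forall F : finFieldType, odd #|F| -> (4 %| #|F| ^ 3 - #|F|)%N ->
         let q : R := #|F|%:R in
         let c : R := (num_pow_classes 4 F)%:R in
         let s : R := (num_pow 4 F)%:R in
         [/\ #|F| = 1 %[mod 8] ->
               c = (3 * q + 21) / 8 /\
               s = 3 / 8 * q ^+ 3 - 1 / 2 * q ^+ 2 - 7 / 8 * q + 1,
             #|F| = 3 %[mod 8] ->
               c = (3 * q + 15) / 8 /\ s = 3 / 8 * (q ^+ 3 - q),
             #|F| = 5 %[mod 8] ->
               c = (3 * q + 17) / 8 /\ s = 3 / 8 * (q ^+ 3 - q)
           & #|F| = 7 %[mod 8] ->
               c = (3 * q + 19) / 8 /\
               s = 3 / 8 * q ^+ 3 - 1 / 2 * q ^+ 2 + 1 / 8 * q + 1])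
      /\ ((num_pow_classes 4 (GF q))%:R / (q%:R + 4) : R)
           @[q --> q_infty 4] --> (3 / 8 : R)
      /\ ((num_pow 4 (GF q))%:R / (q%:R ^+ 3 - q%:R) : R)
           @[q --> q_infty 4] --> (3 / 8 : R)
    & forall n : nat, prime n -> odd n ->
      (forall F : finFieldType, odd #|F| -> (n %| #|F| ^ 3 - #|F|)%N ->
         let q : R := #|F|%:R in
         let m : R := n%:R in
         let c : R := (num_pow_classes n F)%:R in
         let s : R := (num_pow n F)%:R in
         [/\ (n %| #|F|)%N ->
               c = q /\ s = (q - 2) * (q ^+ 2 - 1),
             (n %| #|F| - 1)%N ->
               c = (m + 1) * (q - 1) / (2 * m) + 5 /\
               s = (m + 1) * (q ^+ 3 - q) / (2 * m)
           & (n %| #|F| + 1)%N ->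
               c = ((m + 1) * (q - 3) + 4) / (2 * m) + 5 /\
               s = (m + 1) * (q ^+ 3 - q) / (2 * m)])
      /\ ((num_pow_classes n (GF q))%:R / (q%:R + 4) : R)
           @[q --> within [set q : nat | ~~ (n %| q)%N] (q_infty n)]
           --> ((n%:R + 1) / (2 * n%:R) : R)
      /\ ((num_pow n (GF q))%:R / (q%:R ^+ 3 - q%:R) : R)
           @[q --> within [set q : nat | ~~ (n %| q)%N] (q_infty n)]
           --> ((n%:R + 1) / (2 * n%:R) : R)].
Proof.
split.
- have [cvc cvs] := @power_ratios_cvg R 2 (1 / 2) 2 setT
    (fun F q_odd q3 _ _ => square_ratio_bound R F q_odd q3).
  move: cvc cvs; rewrite within_setT => cvc cvs; split => [F q_odd _|//].
  by split; [exact: square_count_1mod4 | exact: square_count_3mod4].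
- have [cvc cvs] := @power_ratios_cvg R 4 (3 / 8) 2 setT
    (fun F q_odd q3 _ _ => fourth_ratio_bound R F q_odd q3).
  move: cvc cvs; rewrite within_setT => cvc cvs; split => [F q_odd _|//].
  split; [exact: fourth_count_1mod8 | exact: fourth_count_3mod8
         | exact: fourth_count_5mod8 | exact: fourth_count_7mod8].
- move=> n n_pr n_odd; split => [F q_odd _|].
    split; [exact: prime_count_pchar | exact: prime_count_split
           | exact: prime_count_nonsplit].
  apply: (@power_ratios_cvg R n _ 5) => F q_odd q3 nq nq3.
  exact: prime_ratio_bound.
Qed.
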